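(* Let $q$ be a power of a prime $p>2$. Let $C\subseteq\mathbb{P}^2$ be a smooth reflexive plane curve defined over $\mathbb{F}_q$ with $\deg(C)\leq q+1$. Then there is a line $L\subseteq\mathbb{P}^2$ defined over $\mathbb{F}_q$ such that $L$ intersects $C$ transversely.
   Context: A plane curve of degree $d$ defined over $\mathbb{F}_q$ is the zero locus in $\mathbb{P}^2$ of a homogeneous polynomial of degree $d$ in $\mathbb{F}_q[x,y,z]$; smooth means nonsingular at every geometric point (over $\overline{\mathbb{F}_q}$). An $\mathbb{F}_q$-line is a line in $\mathbb{P}^2$ defined over $\mathbb{F}_q$. A line $L$ intersects $C$ transversely if $C\cap L$ consists of $d=\deg(C)$ distinct geometric points (points over $\overline{\mathbb{F}_q}$). Reflexivity: the Gauss map $\varphi: C\to(\mathbb{P}^2)^{*}$ sends each smooth point $P$ of $C$ to its tangent line $T_P(C)$, regarded as a point of the dual plane $(\mathbb{P}^2)^{*}$. The dual curve $C^{*}$ is the closure of $\varphi(C)$ in $(\mathbb{P}^2)^{*}$. The Gauss map of the dual curve is a (rational) map $\varphi': C^{*}\to C^{**}$, where $C^{**}\subseteq(\mathbb{P}^2)^{**}$ and $(\mathbb{P}^2)^{**}$ is identified with $\mathbb{P}^2$. The curve $C$ is called reflexive if $C=C^{**}$ and $\varphi'\circ\varphi: C\to C^{**}$ is the identity map. *)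

(* Defs.v *)
From HB Require Import structures.
From mathcomp Require Export all_boot all_order all_algebra all_field.
From mathcomp Require Export mpoly.

Set Implicit Arguments.
Unset Strict Implicit.
Unset Printing Implicit Defensive.

Import GRing.Theory.
Local Open Scope ring_scope.

(* A point of P^2(K) is a nonzero row vector of 'rV[K]_3, two such vectors
   being the same point when they span the same line: (P == Q)%MS.  A line
   a x + b y + c z = 0 is the point (a, b, c) of the dual plane, so that P^2,
   its dual and its bidual all share these coordinates. *)

Section PlaneCurves.

Variable K : closedFieldType.

Implicit Types (f g h : {mpoly K[3]}) (P Q L : 'rV[K]_3).
Implicit Type X : 'rV[K]_3 -> Prop.

Definition zero_locus f P : Prop := P != 0 /\ f.@[P 0] = 0.

Definition on_line L P : Prop := P != 0 /\ P *m L^T = 0.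

Definition gradient f P : 'rV[K]_3 := \row_i (f^`M(i)).@[P 0].

Definition smooth_point f P : Prop := zero_locus f P /\ gradient f P != 0.

Definition smooth_curve f : Prop := forall P, zero_locus f P -> smooth_point f P.

(* Dual coordinates of the tangent line to f = 0 at a smooth point P; this is
   the tangent line of the curve as soon as f is a reduced equation of it. *)
Definition gauss_map f P : 'rV[K]_3 := gradient f P.

Definition vanishes_on h X : Prop := forall P, X P -> h.@[P 0] = 0.

Definition zariski_closure X Q : Prop :=
  Q != 0 /\
  forall (e : nat) h, h \is e.-homog -> vanishes_on h X -> h.@[Q 0] = 0.

Definition gauss_image f L : Prop :=
  exists2 P, smooth_point f P & (L == gauss_map f P)%MS.

Definition dual_curve f : 'rV[K]_3 -> Prop := zariski_closure (gauss_image f).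

(* g generates the homogeneous ideal of X. *)
Definition reduced_equation g X : Prop :=
  (exists e : nat, g \is e.-homog) /\
  forall (e : nat) h, h \is e.-homog ->
    (vanishes_on h X <-> exists r : {mpoly K[3]}, h = r * g).

(* The Gauss map phi' of the dual curve C* is computed from a reduced equation
   g of C*; such a g is unique up to a nonzero scalar.  For smooth C it exists
   unless C* is a point, which is not a curve and has no Gauss map.  The
   composite phi' o phi is a rational map, defined at the points P such that
   phi(P) is a smooth point of C*. *)
Definition reflexive f : Prop :=
  exists g,
    [/\ reduced_equation g (dual_curve f),
        forall P, zero_locus f P <-> dual_curve g P
      & forall P, smooth_point f P -> smooth_point g (gauss_map f P) ->
          (gauss_map g (gauss_map f P) == P)%MS].

Definition transverse (d : nat) f L : Prop :=
  exists P : 'I_d -> 'rV[K]_3,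
    (forall i j, (P i == P j)%MS -> i = j) /\
    forall Q, (zero_locus f Q /\ on_line L Q) <-> exists i, (Q == P i)%MS.

End PlaneCurves.

(* Main.v *)
From HB Require Import structures.
Require Import Defs.
From Stdlib Require Import Classical.
From mathcomp Require Import ring perm.
Import GRing.Theory.
Local Open Scope ring_scope.
Set Implicit Arguments.
Unset Strict Implicit.
Unset Printing Implicit Defensive.

(** Let C be the curve f = 0 over the algebraic closure and write P^(q) for the
    image of P under the q-power Frobenius map.  Consider the form
      h = x^q f_x + y^q f_y + z^q f_z
    of degree q + d - 1, with f_x, f_y, f_z the partial derivatives of f; it
    vanishes at the points P of C whose tangent line passes through P^(q).

    Suppose that no line over the field with q elements is transverse to C.
    Then each such line L is tangent to C at some point P
    ([transverse_of_not_tangent]), and since L and f are fixed by Frobenius, L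
    is also tangent to C at P^(q).  Both points are zeros of h on C, because L
    contains all the conjugates of P.  If P is not fixed, they are two distinct
    points; if it is, then a computation with the Euler relation shows that h
    vanishes to order two along C at P.  In either case L accounts for two
    intersections of C with h = 0, and different lines account for different
    ones, as a point of a smooth curve has only one tangent line.  Bezout's
    theorem ([weighted_bezout]) then gives
      2 (q^2 + q + 1) <= d (q + d - 1) <= (q + 1) 2q,
    which is absurd.

    Bezout's theorem applies only if f does not divide h
    ([frobenius_classical]), and this is where reflexivity enters.  Let g be a
    reduced equation of the dual curve.  Biduality says that the gradient of g
    at grad f (P) is proportional to P for P on C.  Differentiate this relation
    along a tangent vector v at a point P of C which is not fixed by Frobenius
    and where the gradient of g does not vanish.  The derivative of grad f
    along v is always orthogonal to P; if f divides h, it is orthogonal to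
    P^(q) as well, hence proportional to grad f (P).  Then v would be
    proportional to P, although the tangent line has other directions.

    The geometry rests on elimination.  The resultant, with respect to the last
    coordinate, of two forms of degrees m and n is a binary form of degree m n.
    It has a root, so two plane curves always meet ([plane_curves_meet]); hence
    a smooth curve has an irreducible equation, because two components would
    meet in a singular point.  As polynomial rings over a field are factorial
    ([factorial_mpoly]), this equation is a prime element
    ([smooth_curve_prime]).  The number of roots of the resultant gives Bezout's
    inequality, and with it the Nullstellensatz for C. *)

(** * Factorial rings and Gauss's lemma *)

Section Factorial.
Variable R : idomainType.
Implicit Types (a b c x y : R) (s : seq R).

Definition divides a b := exists c, b = c * a.

Definition prime_elt a :=
  [/\ a != 0, a \isn't a GRing.unit
    & forall x y, divides a (x * y) -> divides a x \/ divides a y].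

Definition prime_seq s := forall x, x \in s -> prime_elt x.

Definition factored x :=
  exists u s, [/\ u \is a GRing.unit, prime_seq s & x = u * \prod_(y <- s) y].

(** Uniqueness of the factorization is automatic, since the factors are prime
    elements and not just irreducible ones. *)
Definition factorial_ring := forall x, x != 0 -> factored x.

Lemma dividesMl a b c : divides a b -> divides a (c * b).
Proof. by case=> x ->; exists (c * x); rewrite mulrA. Qed.

Lemma dividesD a b c : divides a b -> divides a c -> divides a (b + c).
Proof. by case=> x -> [y ->]; exists (x + y); rewrite mulrDl. Qed.

Lemma prime_seq_cons x s : prime_seq (x :: s) <-> prime_elt x /\ prime_seq s.
Proof.
split=> [h|[hx hs] y]; last by rewrite inE => /orP[/eqP->|/hs].
split; first by apply: h; rewrite mem_head.
by move=> y ys; apply: h; rewrite inE ys orbT.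
Qed.

Lemma prime_seq_cat s1 s2 : prime_seq s1 -> prime_seq s2 -> prime_seq (s1 ++ s2).
Proof. by move=> h1 h2 x; rewrite mem_cat => /orP[/h1|/h2]. Qed.

Lemma factoredM x y : factored x -> factored y -> factored (x * y).
Proof.
move=> [u [s [uU sP ->]]] [v [t [vU tP ->]]].
exists (u * v), (s ++ t); split; first by rewrite unitrM uU.
  exact: prime_seq_cat.
by rewrite big_cat /= mulrACA.
Qed.

Lemma factored_prime x : prime_elt x -> factored x.
Proof.
move=> xP; exists 1, [:: x]; split; rewrite ?unitr1 ?big_seq1 ?mul1r //.
by move=> y; rewrite inE => /eqP->.
Qed.

Lemma prime_dvd_prod p s :
  prime_elt p -> divides p (\prod_(y <- s) y) -> exists2 y, y \in s & divides p y.
Proof.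
move=> [p0 pU pP]; elim: s => [|y s IH].
  rewrite big_nil => -[c e]; case/negP: pU.
  by apply/unitrPr; exists c; rewrite mulrC -e.
rewrite big_cons => /pP[h|/IH[z zs h]]; first by exists y; rewrite ?mem_head.
by exists z; rewrite // inE zs orbT.
Qed.

(** In p' = a p the prime p' divides a or p, and the first would make p a unit. *)
Lemma prime_divides_sym p p' : prime_elt p -> prime_elt p' ->
  divides p p' -> divides p' p.
Proof.
move=> [p0 pU _] [p'0 p'U p'P] [a e].
have: divides p' (a * p) by exists 1; rewrite mul1r.
case/p'P=> // -[b ea]; case/negP: pU; apply/unitrPr; exists b.
by apply: (mulIf p'0); rewrite mul1r -mulrA -ea mulrC -e.
Qed.

End Factorial.

Section FactorialPoly.
Variable R : idomainType.
Hypothesis factR : factorial_ring R.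
Implicit Types (c : R) (p g h : {poly R}).

(** If c divides x y it divides the product of the leading coefficients, hence
    one of them; removing that leading term leaves a smaller product which c
    still divides. *)
Lemma prime_polyC (c : R) : prime_elt c -> prime_elt c%:P.
Proof.
move=> [c0 cU cP]; split; first by rewrite polyC_eq0.
  by rewrite poly_unitE size_polyC c0 coefC /= cU.
move=> x y; have [n] := ubnP (size x + size y).
elim: n x y => // n IH x y lt_n dvd_xy.
have [-> | x0] := eqVneq x 0; first by left; exists 0; rewrite mul0r.
have [-> | y0] := eqVneq y 0; first by right; exists 0; rewrite mul0r.
have tail (z : {poly R}) : z != 0 -> divides c (lead_coef z) ->
    exists z' : {poly R}, (size z' < size z)%N /\ exists w : {poly R}, z = z' + w * c%:P.
  move=> z0 [a ea]; exists (z - lead_coef z *: 'X^((size z).-1)); split; last first.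
    exists (a *: 'X^((size z).-1)).
    by rewrite ea -!mul_polyC polyCM mulrAC subrK.
  rewrite -(prednK (n := size z)) ?lt0n ?size_poly_eq0 //=.
  apply/leq_sizeP => j le_j; rewrite coefB coefZ coefXn.
  move: le_j; rewrite leq_eqVlt => /orP[/eqP<-|lt_j].
    by rewrite eqxx mulr1 subrr.
  rewrite gtn_eqF // mulr0 subr0 nth_default //.
  by rewrite -(prednK (n := size z)) ?lt0n ?size_poly_eq0.
have: divides c (lead_coef x * lead_coef y).
  by case: dvd_xy => w e; exists (lead_coef w); rewrite -lead_coefM e lead_coefM lead_coefC.
case/cP => [/(tail _ x0)|/(tail _ y0)] [z [szz [w ez]]].
- have: divides c%:P (z * y).
    case: dvd_xy => t et; exists (t - w * y).
    by rewrite mulrBl -et ez mulrDl -[w * y * _]mulrAC addrK.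
  have lt_zy : (size z + size y < n)%N.
    by rewrite -ltnS; apply: leq_trans lt_n; rewrite ltnS ltn_add2r.
  case/(IH _ _ lt_zy) => h; last by right.
  by left; rewrite ez; apply: dividesD h _; exists w.
- have: divides c%:P (x * z).
    case: dvd_xy => t et; exists (t - x * w).
    by rewrite mulrBl -et ez mulrDr -[x * w * _]mulrA addrK.
  have lt_xz : (size x + size z < n)%N.
    by rewrite -ltnS; apply: leq_trans lt_n; rewrite ltnS ltn_add2l.
  case/(IH _ _ lt_xz) => h; first by left.
  by right; rewrite ez; apply: dividesD h _; exists w.
Qed.

(** Gauss's lemma: the prime factors of c can be moved one by one from the left
    hand side into g or h, because they stay prime as constant polynomials. *)
Lemma clear_denominators c p g h : c != 0 -> c *: p = g * h ->
  exists (a b : R) (g' h' : {poly R}), [/\ p = g' * h', g = a *: g' & h = b *: h'].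
Proof.
move=> /factR[u [s [uU sP ->]]]; elim: s sP g h => [|x s IH] sP g h.
  rewrite big_nil mulr1 => e; exists 1, u, g, (u^-1 *: h).
  by rewrite scale1r scalerA divrr // scale1r -scalerAr -e scalerA mulVr ?scale1r.
move/prime_seq_cons: sP => [xP sP]; rewrite big_cons mulrCA -scalerA => e.
have [x0 _ _] := xP.
have xx : x%:P != 0 by rewrite polyC_eq0.
have [_ _ xPP] := prime_polyC xP.
have: divides x%:P (g * h) by rewrite -e -mul_polyC; exists ((u * \prod_(y <- s) y) *: p); rewrite mulrC.
case/xPP=> [] [w ew].
  have /(IH sP)[a [b [g' [h' [e1 e2 e3]]]]] : (u * \prod_(y <- s) y) *: p = w * h.
    by apply: (mulfI xx); rewrite [LHS]mul_polyC e ew [RHS]mulrA [w * _]mulrC.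
  by exists (x * a), b, g', h'; split; rewrite // ew e2 mulrC mul_polyC scalerA.
have /(IH sP)[a [b [g' [h' [e1 e2 e3]]]]] : (u * \prod_(y <- s) y) *: p = g * w.
  by apply: (mulfI xx); rewrite [LHS]mul_polyC e ew [RHS]mulrCA [w * _]mulrC.
by exists a, (x * b), g', h'; split; rewrite // ew e3 mulrC mul_polyC scalerA.
Qed.

Definition primitive p := forall c, prime_elt c -> ~ divides c%:P p.

(** Each prime extracted from p is also removed from a fixed factorization of its
    leading coefficient, so the process stops. *)
Lemma primitive_part p : p != 0 ->
  exists (s : seq R) (p0 : {poly R}), [/\ prime_seq s, primitive p0 & p = (\prod_(y <- s) y) *: p0].
Proof.
move=> p0; have := p0; rewrite -lead_coef_eq0 => /factR[u [s [uU sP e]]].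
have [n le_n] := ubnP (size s).
elim: n s p le_n p0 sP e => // n IH s p le_n p0 sP e.
have [[c [cs [w ew]]]|no] := classic (exists c, c \in s /\ divides c%:P p).
  have w0 : w != 0 by apply: contraNneq p0 => w0; rewrite ew w0 mul0r.
  have c0 : c != 0 by have [] := sP _ cs.
  case: (IH (rem c s) w) => //.
  - by rewrite size_rem //; case: (s) le_n cs.
  - by move=> x /mem_rem /sP.
  - apply: (mulIf c0); move: e.
    rewrite ew lead_coefM lead_coefC => ->.
    by rewrite (perm_big _ (perm_to_rem cs)) /= big_cons -mulrA [X in u * X]mulrC.
  move=> t [p1 [tP p1P e1]]; exists (c :: t), p1; split => //.
    by apply/prime_seq_cons; split => //; apply: sP.
  by rewrite ew e1 big_cons mulrC mul_polyC scalerA.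
exists [::], p; split; rewrite ?big_nil ?scale1r // => c cP [w ew].
have: divides c (lead_coef p) by exists (lead_coef w); rewrite ew lead_coefM lead_coefC.
rewrite e => -[a ea].
have: divides c (\prod_(y <- s) y) by exists (u^-1 * a); rewrite -mulrA -ea mulKr.
case/(prime_dvd_prod cP) => x xs dx.
apply: no; exists x; split=> //.
have [b eb] := prime_divides_sym cP (sP _ xs) dx.
by exists (w * b%:P); rewrite -mulrA -polyCM -eb.
Qed.

(** Here p %| x is divisibility up to a scalar of R, that is, over the field of
    fractions. *)
Lemma primitive_divides p x : p != 0 -> primitive p -> (p %| x)%R -> divides p x.
Proof.
move=> p0 pP /Pdiv.Idomain.dvdpP [[c g] /= c0 e].
have [a [b [g' [p' [ex eg ep]]]]] := clear_denominators c0 e.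
have a0 : b != 0 by apply: contraNneq p0 => b0; rewrite ep b0 scale0r.
have [u [s [uU sP eb]]] := factR a0.
case: s => [|y s] in sP eb.
  rewrite big_nil mulr1 in eb; exists (b^-1 *: g').
  by rewrite {}ex {1}ep -scalerAr -scalerAl scalerA divrr ?scale1r // eb.
move/prime_seq_cons: sP => [yP _]; case: (pP y yP).
exists ((u * \prod_(j <- s) j) *: p').
by rewrite mulrC mul_polyC scalerA mulrCA ep eb big_cons.
Qed.

(** By induction on the degree: a polynomial which splits over the field of
    fractions splits over R by Gauss's lemma; one which does not is a constant
    times a primitive polynomial, and the latter is prime since it is prime
    over the field of fractions. *)
Lemma factorial_poly : factorial_ring {poly R}.
Proof.
move=> p; have [n] := ubnP (size p).
elim: n p => // n IH p lt_n p0.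
have fC (c : R) : c != 0 -> factored c%:P.
  case/factR => u [s [uU sP ->]]; exists u%:P, [seq y%:P | y <- s]; split.
  - have u0 : u != 0 by apply: contraTneq uU => ->; rewrite unitr0.
    by rewrite poly_unitE size_polyC coefC /= uU u0.
  - by move=> x /mapP[y /sP yP ->]; apply: prime_polyC.
  - by rewrite polyCM rmorph_prod big_map.
have [s1|s2] := leqP (size p) 1.
  by rewrite (size1_polyC s1); apply: fC; rewrite -polyC_eq0 -size1_polyC.
have [[c [g [h [c0 e sg1 sgp]]]]|irr] := classic (exists (c : R) (g h : {poly R}),
    [/\ c != 0, c *: p = g * h, (1 < size g)%N & (size g < size p)%N]).
  have [a [b [g' [h' [ep eg eh]]]]] := clear_denominators c0 e.
  have /andP[g0 h0] : (g' != 0) && (h' != 0) by rewrite -negb_or -mulf_eq0 -ep.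
  have sz : size g = size g'.
    rewrite eg size_scale //; apply: contraTneq sg1 => a0.
    by rewrite eg a0 scale0r size_poly0.
  have := size_mul g0 h0; rewrite -ep => szp.
  rewrite ep; apply: factoredM; apply: IH => //.
    by rewrite -sz (leq_trans sgp).
  have : (size h' < size p)%N.
    by rewrite szp -sz; case: (size g) sg1 => [|[|k]] // _; rewrite !addSn ltnS leq_addl.
  by move=> /leq_trans; apply.
have [s [q [sP qP ep]]] := primitive_part p0.
have cs0 : \prod_(y <- s) y != 0 by apply: contraNneq p0 => e; rewrite ep e scale0r.
have q0 : q != 0 by apply: contraNneq p0 => e; rewrite ep e scaler0.
have szq : size q = size p by rewrite ep size_scale.
rewrite ep -mul_polyC; apply: factoredM; first exact: fC.
apply: factored_prime; split=> //.
  by rewrite poly_unitE szq gtn_eqF.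
move=> x y [w exy].
have dvd_xy : q %| x * y by apply/Pdiv.Idomain.dvdpP; exists (1, w); rewrite ?oner_eq0 ?scale1r.
have /Pdiv.Idomain.dvdpP[[c g] /= c0 e] := dvdp_gcdl q x.
(* The gcd of q and x divides q, so it is either constant or associate to q. *)
have [G1|G1] := leqP (size (gcdp q x)) 1.
  right; apply: primitive_divides => //.
  rewrite -(Gauss_dvdpr _ (_ : coprimep q x)) //.
  by rewrite /coprimep eqn_leq G1 lt0n size_poly_eq0 gcdp_eq0 negb_and q0.
left; apply: primitive_divides => //.
have leG := dvdp_leq q0 (dvdp_gcdl q x).
have [ltG|geG] := ltnP (size (gcdp q x)) (size q).
  case: irr; exists c, (gcdp q x), ((\prod_(j <- s) j) *: g).
  split; rewrite -?szq //.
  by rewrite ep scalerA [c * _]mulrC -scalerA e -scalerAr mulrC.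
have /eqp_dvdl <- : gcdp q x %= q.
  by rewrite -(dvdp_size_eqp (dvdp_gcdl q x)) eqn_leq leG geG.
exact: dvdp_gcdr.
Qed.

End FactorialPoly.

(** * Multivariate polynomials as polynomials in their last variable *)

Section Ring.
Variables (R : comNzRingType) (n : nat).

Lemma mpoly_ring_ind (P : {mpoly R[n]} -> Prop) :
  (forall c, P c%:MP) -> (forall i, P 'X_i) ->
  (forall p q, P p -> P q -> P (p + q)) ->
  (forall p q, P p -> P q -> P (p * q)) -> forall p, P p.
Proof.
move=> PC PX PD PM p; rewrite [p]mpolyE.
apply: big_ind => [|//|m _]; first by rewrite -[0](mpolyC0 n); apply: PC.
rewrite -mul_mpolyC mpolyXE_id; apply: (PM) => //.
apply: big_ind => [|x y|i _]; [by rewrite -mpolyC1; apply: PC|exact: PM|].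
elim: (m i) => [|k IH]; first by rewrite expr0 -mpolyC1; apply: PC.
by rewrite exprS; apply: PM.
Qed.

Lemma mpoly_morph_ext (S : comNzRingType) (phi psi : {rmorphism {mpoly R[n]} -> S}) :
  (forall c, phi c%:MP = psi c%:MP) -> (forall i, phi 'X_i = psi 'X_i) -> phi =1 psi.
Proof.
move=> eC eX; apply: mpoly_ring_ind => // p q ep eq.
  by rewrite !rmorphD ep eq.
by rewrite !rmorphM ep eq.
Qed.

End Ring.

Section Muni.
Variables (R : comNzRingType) (n : nat).

Local Notation widen := (widen_ord (leqnSn n)).

Lemma muni_Xmax : muni ('X_ord_max : {mpoly R[n.+1]}) = 'X.
Proof.
rewrite muniE msuppX big_seq1 mcoeffX eqxx scale1r mnm1E eqxx expr1.
rewrite (_ : [multinom _ | i < n] = 0%MM) ?mpolyX0 ?scale1r //.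
by apply/mnmP => i; rewrite mnmE mnm0E mnm1E -val_eqE /= gtn_eqF.
Qed.

Lemma muni_Xwiden i : muni ('X_(widen i) : {mpoly R[n.+1]}) = ('X_i)%:P.
Proof.
rewrite muniE msuppX big_seq1 mcoeffX eqxx scale1r mnm1E.
rewrite -val_eqE /= ltn_eqF // expr0 alg_polyC; congr ('X_[_])%:P.
by apply/mnmP => j; rewrite !mnmE -!val_eqE.
Qed.

Lemma muni_mwiden (p : {mpoly R[n]}) : muni (mwiden p) = p%:P.
Proof.
move: p; apply: mpoly_ring_ind => [c|i|p q ep eq|p q ep eq].
- by rewrite mwidenC muniC.
- by rewrite mwidenX mnmwiden1 muni_Xwiden.
- by rewrite mwidenD muniD ep eq polyCD.
- by rewrite mwidenM muniM ep eq polyCM.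
Qed.

Lemma mpoly_widen_ind (P : {mpoly R[n.+1]} -> Prop) :
  (forall c, P c%:MP) -> (forall i, P 'X_(widen i)) -> P 'X_ord_max ->
  (forall p q, P p -> P q -> P (p + q)) ->
  (forall p q, P p -> P q -> P (p * q)) -> forall p, P p.
Proof.
move=> PC PX PM; apply: mpoly_ring_ind => // i.
have [j ->|->] := unliftP ord_max i => //.
by rewrite (_ : lift _ _ = widen j) //; apply: val_inj; rewrite /= /bump leqNgt ltn_ord.
Qed.

(** A morphism on polynomials in n + 1 variables may be computed by first
    mapping the coefficients of the univariate presentation and then
    substituting for the last variable. *)
Lemma muni_morph (S T : comNzRingType) (chi : {rmorphism {mpoly R[n]} -> S})
    (ev : {rmorphism {poly S} -> T}) (psi : {rmorphism {mpoly R[n.+1]} -> T}) :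
  (forall c, psi c%:MP = ev (chi c%:MP)%:P) ->
  (forall i, psi 'X_(widen i) = ev (chi 'X_i)%:P) -> psi 'X_ord_max = ev 'X ->
  forall p, psi p = ev (map_poly chi (muni p)).
Proof.
move=> eC eX eM; apply: mpoly_widen_ind => [c|i||p q ep eq|p q ep eq].
- by rewrite eC muniC map_polyC.
- by rewrite eX muni_Xwiden map_polyC.
- by rewrite eM muni_Xmax map_polyX.
- by rewrite (rmorphD psi) ep eq muniD (rmorphD (map_poly chi)) (rmorphD ev).
- by rewrite (rmorphM psi) ep eq muniM (rmorphM (map_poly chi)) (rmorphM ev).
Qed.

Definition of_muni (p : {poly {mpoly R[n]}}) : {mpoly R[n.+1]} :=
  (map_poly (@mwiden n R) p).['X_ord_max].

HB.instance Definition _ := GRing.RMorphism.copy of_muni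
  (horner_eval ('X_ord_max : {mpoly R[n.+1]}) \o map_poly (@mwiden n R)).

Lemma muniK : cancel (@muni n R) of_muni.
Proof.
move=> p; rewrite /of_muni; move: p.
apply: mpoly_widen_ind => [c|i||p q ep eq|p q ep eq].
- by rewrite muniC map_polyC hornerC /= mwidenC.
- by rewrite muni_Xwiden map_polyC hornerC /= mwidenX mnmwiden1.
- by rewrite muni_Xmax map_polyX hornerX.
- by rewrite muniD (rmorphD (map_poly (@mwiden n R))) hornerD; congr (_ + _); [exact: ep|exact: eq].
- by rewrite muniM (rmorphM (map_poly (@mwiden n R))) hornerM; congr (_ * _); [exact: ep|exact: eq].
Qed.

Lemma of_muniK : cancel of_muni (@muni n R).
Proof.
rewrite /of_muni; elim/poly_ind => [|p c IH].
  by rewrite rmorph0 horner0 muni0.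
by rewrite rmorphD rmorphM /= map_polyX map_polyC hornerD hornerM hornerX hornerC
  muniD muniM /= IH muni_Xmax muni_mwiden.
Qed.

Lemma dhomog_muni_coef d (p : {mpoly R[n.+1]}) k :
  p \is d.-homog -> (k <= d)%N -> (muni p)`_k \is (d - k)%N.-homog.
Proof.
move=> /dhomogP hp le_kd; rewrite muniE coef_sum big_seq rpred_sum // => m mp.
rewrite coefZ coefXn; have [ek|_] := eqVneq k (m ord_max); last first.
  by rewrite mulr0 dhomog0.
rewrite mulr1 dhomogZ // dhomogX -(hp m mp) /= !mdegE.
rewrite big_ord_recr /= ek addnK; apply/eqP/eq_bigr => i _.
by rewrite mnmE.
Qed.

Lemma muni_coef_gt d (p : {mpoly R[n.+1]}) k :
  p \is d.-homog -> (d < k)%N -> (muni p)`_k = 0.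
Proof.
move=> /dhomogP hp lt_dk; rewrite muniE coef_sum big_seq big1 // => m mp.
rewrite coefZ coefXn; have [ek|_] := eqVneq k (m ord_max); last first.
  by rewrite mulr0.
move: lt_dk; rewrite -(hp m mp) /= mdegE big_ord_recr /= ek.
by rewrite ltnNge leq_addl.
Qed.

End Muni.

Section RingIso.
Variables (R S : idomainType) (phi : {rmorphism R -> S}) (psi : {rmorphism S -> R}).
Hypotheses (phiK : cancel phi psi) (psiK : cancel psi phi).

Lemma prime_iso a : prime_elt a -> prime_elt (phi a).
Proof.
case=> a0 aU aP; split.
- by rewrite -(rmorph0 phi) (can_eq phiK).
- by apply: contra aU => /(rmorph_unit psi); rewrite phiK.
move=> x y [c e]; have: divides a (psi x * psi y).
  by exists (psi c); rewrite -rmorphM e rmorphM phiK.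
have lift b z : divides b (psi z) -> divides (phi b) z.
  by case=> w ew; exists (phi w); rewrite -rmorphM -ew psiK.
by case/aP => /lift; [left|right].
Qed.

End RingIso.

Lemma factorial_iso (R S : idomainType) (phi : {rmorphism R -> S})
    (psi : {rmorphism S -> R}) :
  cancel phi psi -> cancel psi phi -> factorial_ring S -> factorial_ring R.
Proof.
move=> phiK psiK fS x x0.
have phi0 : phi x != 0 by rewrite -(rmorph0 phi) (can_eq phiK).
have [u [s [uU sP e]]] := fS _ phi0.
exists (psi u), (map psi s); split.
- exact: rmorph_unit.
- by move=> y /mapP[z /sP zP ->]; apply: (prime_iso psiK phiK).
by rewrite -[LHS]phiK e rmorphM rmorph_prod big_map.
Qed.

Theorem factorial_mpoly (K : fieldType) n : factorial_ring {mpoly K[n]}.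
Proof.
elim: n => [|n IH].
  move=> p p0; exists p, [::]; split=> //; last by rewrite big_nil mulr1.
  have p0C : p = (p@_0)%:MP by rewrite mpolyKC.
  apply/andP; split; first by rewrite -p0C.
  by rewrite unitfE; apply: contraNneq p0 => e; rewrite p0C e mpolyC0.
exact: factorial_iso (@muniK K n) (@of_muniK K n) (factorial_poly IH).
Qed.

(** * Derivatives, homogeneity and restriction to lines *)

Section Calculus.
Variables (R : comNzRingType) (n : nat).
Implicit Types (p q : {mpoly R[n]}).

Lemma mderiv_XU i j : ('X_j)^`M(i) = (i == j)%:R :> {mpoly R[n]}.
Proof.
rewrite mderivX mnm1E eq_sym; case: eqP => [->|_]; last by rewrite scale0r.
rewrite scale1r (_ : (_ - _)%MM = 0%MM) ?mpolyX0 //.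
by apply/mnmP => k; rewrite mnmBE mnm0E subnn.
Qed.

(** Both sides are derivations in p, so they agree once they agree on the
    variables. *)
Lemma mderiv_comp k (t : n.-tuple {mpoly R[k]}) p j :
  (p \mPo t)^`M(j) = \sum_i (p^`M(i) \mPo t) * (tnth t i)^`M(j).
Proof.
move: p; apply: mpoly_ring_ind => [c|i|p q ep eq|p q ep eq].
- by rewrite comp_mpolyC mderivC big1 // => i _; rewrite mderivC comp_mpoly0 mul0r.
- rewrite comp_mpolyXU -tnth_nth (bigD1 i) //= mderiv_XU eqxx rmorph1 mul1r big1 ?addr0 //.
  by move=> l /negPf nl; rewrite mderiv_XU nl rmorph0 mul0r.
- rewrite rmorphD mderivD ep eq -big_split /=; apply: eq_bigr => i _.
  by rewrite mderivD rmorphD mulrDl.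
- rewrite rmorphM mderivM ep eq mulr_suml mulr_sumr -big_split /=.
  apply: eq_bigr => i _; rewrite mderivM rmorphD !rmorphM /=; ring.
Qed.

Lemma euler d p : p \is d.-homog -> \sum_i 'X_i * p^`M(i) = p *+ d.
Proof.
move=> /dhomogP hp; rewrite {2}[p]mpolyE -sumrMnl.
have -> : \sum_i 'X_i * p^`M(i) =
    \sum_i \sum_(m <- msupp p) p@_m *: ('X_[m] *+ m i).
  apply: eq_bigr => i _; rewrite {1}[p]mpolyE raddf_sum mulr_sumr /=.
  apply: eq_bigr => m _; rewrite mderivZ -scalerAr mderivX -scalerAr scaler_nat.
  congr (_ *: _); have [->|mi] := eqVneq (m i) 0%N; first by rewrite !mulr0n.
  rewrite -mpolyXD; congr ('X_[_] *+ _); apply/mnmP => j.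
  rewrite mnmDE mnmBE mnm1E; case: eqVneq => [<-|]; last by rewrite subn0.
  by rewrite addnC subnK // lt0n.
rewrite exchange_big; apply: eq_big_seq => m mp /=.
by rewrite -scaler_sumr sumrMnr -mdegE hp // scalerMnr.
Qed.

Lemma meval_homogZ d p (c : R) (v w : 'I_n -> R) : p \is d.-homog ->
  (forall i, w i = c * v i) -> p.@[w] = c ^+ d * p.@[v].
Proof.
move=> /dhomogP hp ew; rewrite !mevalE mulr_sumr; apply: eq_big_seq => m mp.
rewrite mulrCA; congr (_ * _); rewrite -(hp m mp) /= mdegE -prodrXr -big_split /=.
by apply: eq_bigr => i _; rewrite ew exprMn.
Qed.

Lemma dhomog_mderiv d p i : p \is d.-homog -> p^`M(i) \is d.-1.-homog.
Proof.
move=> /dhomogP hp; rewrite {1}[p]mpolyE raddf_sum big_seq rpred_sum //= => m mp.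
rewrite mderivZ mderivX dhomogZ //.
have [->|mi] := eqVneq (m i) 0%N; first by rewrite scale0r dhomog0.
rewrite dhomogZ // dhomogX -(hp m mp) /= -(eqn_add2r (mdeg U_(i)%MM)) -mdegD.
rewrite submK; last by apply/mnm_lepP => j; rewrite mnm1E; case: eqVneq => // <-; rewrite lt0n.
rewrite mdeg1 addn1 prednK // mdegE (bigD1 i) //= addn_gt0 lt0n mi //.
Qed.

Lemma dhomog_comp k d e p (t : n.-tuple {mpoly R[k]}) : p \is d.-homog ->
  (forall i, tnth t i \is e.-homog) -> p \mPo t \is (d * e)%N.-homog.
Proof.
move=> /dhomogP hp ht; rewrite comp_mpolyEX big_seq rpred_sum // => m mp.
rewrite dhomogZ // comp_mpolyX -(hp m mp) /= mdegE.
elim/big_rec2: _ => [|i x y _ hy]; first exact: dhomog1.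
by rewrite mulnDl dhomogM // mulnC dhomogMn.
Qed.

(** The restriction of p to the parametrized line T |-> v + T w; its value and its
    derivative at T = 0 encode vanishing at v and tangency to w there. *)
Definition along (v w : 'I_n -> R) p : {poly R} :=
  mmap (@polyC R) (fun i => (v i)%:P + w i *: 'X) p.

HB.instance Definition _ v w := GRing.RMorphism.copy (along v w)
  (mmap (@polyC R) (fun i => (v i)%:P + w i *: 'X)).

Lemma alongC v w c : along v w c%:MP = c%:P.
Proof. exact: mmapC. Qed.

Lemma alongX v w i : along v w 'X_i = (v i)%:P + w i *: 'X.
Proof. by rewrite /along mmapX mmap1U. Qed.

Lemma horner_along v w p x : (along v w p).[x] = p.@[fun i => v i + w i * x].
Proof.
move: p; apply: mpoly_ring_ind => [c|i|p q ep eq|p q ep eq].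
- by rewrite alongC hornerC mevalC.
- by rewrite alongX !hornerE mevalXU.
- by rewrite !rmorphD hornerD ep eq.
- by rewrite !rmorphM hornerM ep eq.
Qed.

Lemma deriv_along v w p : (along v w p)^`() = \sum_i w i *: along v w p^`M(i).
Proof.
move: p; apply: mpoly_ring_ind => [c|i|p q ep eq|p q ep eq].
- by rewrite alongC derivC big1 // => i _; rewrite mderivC rmorph0 scaler0.
- rewrite alongX derivD derivC derivZ derivX add0r (bigD1 i) //= mderiv_XU eqxx.
  rewrite rmorph1 big1 ?addr0 // => l /negPf nl.
  by rewrite mderiv_XU nl rmorph0 scaler0.
- rewrite rmorphD derivD ep eq -big_split /=; apply: eq_bigr => i _.
  by rewrite mderivD rmorphD scalerDr.
- rewrite rmorphM derivM ep eq mulr_suml mulr_sumr -big_split /=.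
  apply: eq_bigr => i _; rewrite mderivM rmorphD !rmorphM scalerDr.
  by rewrite scalerAl scalerAr.
Qed.

Lemma along_coef0 v w p : (along v w p)`_0 = p.@[v].
Proof.
rewrite -horner_coef0 horner_along; apply: meval_eq => i; by rewrite mulr0 addr0.
Qed.

Lemma along_coef1 v w p : (along v w p)`_1 = \sum_i w i * p^`M(i).@[v].
Proof.
have := coef_deriv (along v w p) 0; rewrite mulr1n => <-.
rewrite deriv_along coef_sum; apply: eq_bigr => i _.
by rewrite coefZ along_coef0.
Qed.

(** The leading coefficient is the value at the point at infinity of the line. *)
Lemma along_homog d v w p : p \is d.-homog ->
  (size (along v w p) <= d.+1)%N /\ (along v w p)`_d = p.@[w].
Proof.
move=> /dhomogP hp.
pose ok e (x : {poly R}) (c : R) := (size x <= e.+1)%N /\ x`_e = c.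
have okM e1 x c1 e2 y c2 : ok e1 x c1 -> ok e2 y c2 -> ok (e1 + e2)%N (x * y) (c1 * c2).
  move=> [sx cx] [sy cy]; split.
    apply: leq_trans (size_polyMleq _ _) _.
    by rewrite -subn1 leq_subLR add1n -addnS -addSn leq_add.
  rewrite coefM (bigD1 (inord e1)) //= inordK ?ltnS ?leq_addr // addKn cx cy big1 ?addr0 //.
  move=> i ne; have [lt|] := ltnP i e1.
    rewrite [y`_ _]nth_default ?mulr0 //; apply: leq_trans sy _.
    by rewrite -addnBAC ?(ltnW lt) // -[X in (X < _)%N]add0n ltn_add2r subn_gt0.
  rewrite leq_eqVlt => /orP[/eqP ei|lt].
    by case/eqP: ne; apply: val_inj; rewrite /= inordK ?ltnS ?leq_addr.
  by rewrite [x`_ _]nth_default ?mul0r //; apply: leq_trans sx _.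
have okX i k : ok k (((v i)%:P + w i *: 'X) ^+ k) (w i ^+ k).
  elim: k => [|k IH]; first by split; rewrite ?expr0 ?size_poly1 // coef1.
  rewrite !exprS; apply: (okM 1%N) => //; split.
    apply: leq_trans (size_polyD _ _) _; rewrite geq_max size_polyC.
    by rewrite (leq_trans (leq_b1 _)) // (leq_trans (size_scale_leq _ _)) ?size_polyX.
  by rewrite coefD coefC coefZ coefX add0r mulr1.
have okm m : ok (mdeg m) (along v w 'X_[m]) (\prod_i w i ^+ m i).
  rewrite mdegE /along mmapX /mmap1.
  elim/big_rec3: _ => [|i x y z _ IH]; first by split; rewrite ?size_poly1 ?coef1.
  exact: okM.
have -> : along v w p = \sum_(m <- msupp p) p@_m *: along v w 'X_[m].
  by rewrite {1}[p]mpolyE rmorph_sum; apply: eq_bigr => m _; rewrite -mul_mpolyC rmorphM /= alongC mul_polyC.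
rewrite mevalE; split.
  apply: leq_trans (size_sum _ _ _) _; apply/bigmax_leqP_seq => m mp _.
  apply: leq_trans (size_scale_leq _ _) _.
  by rewrite -(hp m mp); case: (okm m).
rewrite coef_sum; apply: eq_big_seq => m mp; rewrite coefZ; congr (_ * _).
by rewrite -(hp m mp); case: (okm m).
Qed.

End Calculus.

(** * Vector algebra in the projective plane *)

Definition o0 : 'I_3 := Ordinal (isT : 0 < 3)%N.
Definition o1 : 'I_3 := Ordinal (isT : 1 < 3)%N.
Definition o2 : 'I_3 := Ordinal (isT : 2 < 3)%N.

Lemma ord3P (i : 'I_3) : [\/ i = o0, i = o1 | i = o2].
Proof.
case: i => [[|[|[|//]]] h]; [apply: Or31|apply: Or32|apply: Or33]; exact: val_inj.
Qed.

Lemma sum3 (V : nmodType) (F : 'I_3 -> V) : \sum_i F i = F o0 + F o1 + F o2.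
Proof.
rewrite !big_ord_recl big_ord0 addr0 addrA.
by congr (F _ + F _ + F _); apply: val_inj.
Qed.

Definition row3 (R : nzRingType) (a b c : R) : 'rV[R]_3 := \row_i nth 0 [:: a; b; c] i.

Lemma row3E (R : nzRingType) (a b c : R) :
  (row3 a b c 0 o0 = a) * (row3 a b c 0 o1 = b) * (row3 a b c 0 o2 = c).
Proof. by rewrite /row3 !mxE. Qed.

Lemma row3P (R : nzRingType) (u v : 'rV[R]_3) :
  u 0 o0 = v 0 o0 -> u 0 o1 = v 0 o1 -> u 0 o2 = v 0 o2 -> u = v.
Proof. by move=> e0 e1 e2; apply/rowP => i; have [] := ord3P i => ->. Qed.

(** Incidence and proportionality of points and lines are both expressed by
    equations: dot P L = 0 means that P lies on L, and cross P Q = 0 that P and Q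
    are the same point. *)
Definition dot (R : nzRingType) (u v : 'rV[R]_3) := \sum_i u 0 i * v 0 i.

Definition cross (R : nzRingType) (u v : 'rV[R]_3) : 'rV[R]_3 :=
  row3 (u 0 o1 * v 0 o2 - u 0 o2 * v 0 o1)
       (u 0 o2 * v 0 o0 - u 0 o0 * v 0 o2)
       (u 0 o0 * v 0 o1 - u 0 o1 * v 0 o0).


Lemma dotE (R : nzRingType) (u v : 'rV[R]_3) :
  dot u v = u 0 o0 * v 0 o0 + u 0 o1 * v 0 o1 + u 0 o2 * v 0 o2.
Proof. exact: sum3. Qed.

(* Identities between dot and cross products are polynomial identities between
   the coordinates. *)
Ltac cross_ring := rewrite ?dotE; try apply: row3P; rewrite ?(mxE, row3E) /=; ring.

Section Plane.
Variable K : closedFieldType.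
Implicit Types (u v w P Q O : 'rV[K]_3).

(** An algebraically closed field is infinite: choose the first n coordinates so
    that the leading coefficient in the last variable survives. *)
Lemma mpoly_neq0_eval n (p : {mpoly K[n]}) : p != 0 -> exists v : 'I_n -> K, p.@[v] != 0.
Proof.
elim: n p => [|n IH] p p0.
  exists (fun=> 0); rewrite -[X in X.@[_]]mpolyKC (@mevalC 0 K).
  by apply: contraNneq p0 => h; rewrite -[p]mpolyKC h mpolyC0.
have mp0 : muni p != 0 by apply: contraNneq p0 => e; rewrite -[p](muniK) e /of_muni rmorph0 horner0.
have [v vP] := IH (lead_coef (muni p)) ltac:(by rewrite lead_coef_eq0).
have : map_poly (meval v) (muni p) != 0.
  by apply: contraNneq vP => /polyP/(_ (size (muni p)).-1); rewrite coef_map coef0 => ->.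
move=> /closed_nonrootP[z zP].
pose V i := if unlift ord_max i is Some j then v j else z.
exists V; rewrite (muni_morph (chi := meval v) (ev := horner_eval z)) //.
- by move=> c /=; rewrite !mevalC horner_evalE hornerC.
- move=> i /=; rewrite !mevalXU horner_evalE hornerC /V.
  rewrite (_ : widen_ord _ _ = lift ord_max i) ?liftK //.
  by apply: val_inj; rewrite /= /bump leqNgt ltn_ord.
- by rewrite /= mevalXU horner_evalE hornerX /V unlift_none.
Qed.

Lemma dotC u v : dot u v = dot v u.
Proof. by apply: eq_bigr => i _; rewrite mulrC. Qed.

Lemma dotZl c u v : dot (c *: u) v = c * dot u v.
Proof. by rewrite /dot mulr_sumr; apply: eq_bigr => i _; rewrite mxE mulrA. Qed.

Lemma dotZr c u v : dot u (c *: v) = c * dot u v.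
Proof. by rewrite dotC dotZl dotC. Qed.

Lemma dotDr u v w : dot u (v + w) = dot u v + dot u w.
Proof. by rewrite /dot -big_split; apply: eq_bigr => i _; rewrite mxE mulrDr. Qed.

Lemma dot0r u : dot u 0 = 0.
Proof. by rewrite /dot big1 // => i _; rewrite mxE mulr0. Qed.

Lemma mulmx_trE u v : u *m v^T = (dot u v)%:M.
Proof.
by apply/rowP => i; rewrite !mxE !ord1; apply: eq_bigr => j _; rewrite mxE.
Qed.

Lemma mulmx_tr_eq0 u v : u *m v^T = 0 <-> dot u v = 0.
Proof.
rewrite mulmx_trE; split=> [/matrixP/(_ 0 0)|->]; first by rewrite !mxE.
by apply/rowP => i; rewrite !mxE mul0rn.
Qed.

Lemma crossvv u : cross u u = 0. Proof. cross_ring. Qed.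
Lemma crossC u v : cross v u = - cross u v. Proof. cross_ring. Qed.
Lemma crossZl c u v : cross (c *: u) v = c *: cross u v. Proof. cross_ring. Qed.
Lemma crossZr c u v : cross u (c *: v) = c *: cross u v. Proof. cross_ring. Qed.
Lemma crossDr u v w : cross u (v + w) = cross u v + cross u w. Proof. cross_ring. Qed.
Lemma cross0r u : cross u 0 = 0. Proof. cross_ring. Qed.
Lemma dot_cross_l u v : dot u (cross u v) = 0. Proof. cross_ring. Qed.
Lemma dot_cross_r u v : dot v (cross u v) = 0. Proof. cross_ring. Qed.
Lemma dot_crossA u v w : dot (cross u v) w = dot u (cross v w). Proof. cross_ring. Qed.
Lemma double_cross u v w : cross u (cross v w) = dot u w *: v - dot u v *: w.
Proof. cross_ring. Qed.

Lemma cross_eq0C u v : (cross u v == 0) = (cross v u == 0).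
Proof. by rewrite crossC oppr_eq0. Qed.

Lemma exists_coord_neq0 u : u != 0 -> exists k, u 0 k != 0.
Proof.
move=> u0; apply/existsP; apply: contraR u0 => /existsPn h.
by apply/eqP/rowP => k; rewrite mxE; apply/eqP/negPn; exact: h.
Qed.

Lemma row3_100_neq0 : row3 1 0 0 != 0 :> 'rV[K]_3.
Proof. by apply/eqP => /rowP/(_ o0)/eqP; rewrite row3E mxE oner_eq0. Qed.

Lemma dot_neq0 u : u != 0 -> exists w, dot u w != 0.
Proof.
move=> /exists_coord_neq0[k uk].
exists (delta_mx 0 k); rewrite /dot (bigD1 k) //= big1 => [|i /negPf ne].
  by rewrite mxE !eqxx mulr1 addr0.
by rewrite mxE ne andbF mulr0.
Qed.

(** Expand u x v crossed with a vector w such that dot u w is nonzero. *)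
Lemma cross_eq0P u v : u != 0 -> cross u v = 0 -> exists c, v = c *: u.
Proof.
move=> /dot_neq0[w w0] e.
have := double_cross w u v; rewrite e cross0r => /esym/eqP; rewrite subr_eq0.
move=> /eqP e'; exists ((dot w u)^-1 * dot w v).
by rewrite -scalerA e' scalerA mulVf ?scale1r // dotC.
Qed.

Lemma eq_pointP u v : u != 0 -> v != 0 -> reflect (cross u v = 0) (u == v)%MS.
Proof.
move=> u0 v0; apply: (iffP andP) => [[/sub_rVP[a ->] _]|e].
  by rewrite crossZl crossvv scaler0.
split; apply/sub_rVP.
  by apply: (cross_eq0P v0); rewrite crossC e oppr0.
exact: (cross_eq0P u0).
Qed.

Definition linear_form w : {mpoly K[3]} := \sum_i w 0 i *: 'X_i.

Lemma meval_linear_form w P : (linear_form w).@[P 0] = dot w P.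
Proof.
by rewrite rmorph_sum; apply: eq_bigr => i _; rewrite /= mevalZ mevalXU.
Qed.

Lemma dhomog_linear_form w : linear_form w \is 1.-homog.
Proof. by rewrite rpred_sum // => i _; rewrite dhomogZ // dhomogX /= mdeg1. Qed.

Lemma linear_form_neq0 w : w != 0 -> linear_form w != 0.
Proof.
move=> /dot_neq0[P]; apply: contraNneq => e.
by rewrite -meval_linear_form e rmorph0.
Qed.

Lemma meval_row (p : {mpoly K[3]}) (v : 'I_3 -> K) : p.@[(\row_i v i) 0] = p.@[v].
Proof. by apply: meval_eq => i; rewrite mxE. Qed.

(** Finitely many nonzero linear forms and p have a nonzero product. *)
Lemma generic_point (p : {mpoly K[3]}) (ws : seq 'rV[K]_3) :
  p != 0 -> (forall w, w \in ws -> w != 0) ->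
  exists P, p.@[P 0] != 0 /\ forall w, w \in ws -> dot w P != 0.
Proof.
move=> p0 hw; have : p * \prod_(w <- ws) linear_form w != 0.
  rewrite mulf_neq0 // prodf_seq_neq0; apply/allP => w /hw w0.
  exact: linear_form_neq0.
move=> /mpoly_neq0_eval[v]; rewrite -meval_row rmorphM mulf_eq0 negb_or.
rewrite rmorph_prod prodf_seq_neq0 => /andP[p1 /allP h].
exists (\row_i v i); split=> // w /h /=.
by rewrite meval_linear_form.
Qed.

End Plane.

(** * Elimination of the last coordinate *)

Section Resultant.
Variable R : idomainType.

Definition graded_coefs n (d : nat) (a : {poly {mpoly R[n]}}) :=
  forall k, if (k <= d)%N then a`_k \is (d - k)%N.-homog else a`_k == 0.

(** In the Leibniz expansion of the Sylvester determinant, an entry in row i and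
    column j has degree w i - j for a weight w depending on the row only, so all
    the products over permutations have the same degree. *)
Lemma dhomog_resultant n d e (a b : {poly {mpoly R[n]}}) :
  size a = d.+1 -> size b = e.+1 -> graded_coefs d a -> graded_coefs e b ->
  resultant a b \is (d * e)%N.-homog.
Proof.
move=> sa sb ha hb; have ed : d = (size a).-1 by rewrite sa.
have ee : e = (size b).-1 by rewrite sb.
move: ha hb; rewrite {}ed {}ee => ha hb {sa sb d e}; rewrite /resultant; set S := Sylvester_mx a b.
set dA := (size a).-1 in ha *; set dB := (size b).-1 in hb *.
pose w (i : 'I_(dB + dA)) := match split i with inl i => (dA + i)%N | inr i => (dB + i)%N end.
pose ok e j (x : {mpoly R[n]}) := x = 0 \/ exists c, (c + j)%N = e /\ x \is c.-homog.
have ok_shift (c : {poly {mpoly R[n]}}) d i j : graded_coefs d c ->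
    ok (d + i)%N j (c`_(j - i) *+ (i <= j)%N).
  move=> /(_ (j - i)%N) hc; have [le_ij|] := leqP i j; last by left; rewrite mulr0n.
  rewrite mulr1n; move: hc; case: leqP => [le_d hc|_ /eqP]; last by left.
  right; exists (d - (j - i))%N; split=> //.
  by rewrite -[X in (_ + X)%N](subnK le_ij) addnA subnK.
have okS i j : ok (w i) (val j) (S i j).
  by rewrite Sylvester_mxE /w; case: (split i) => k; apply: ok_shift.
have sum_w : (\sum_i w i = dA * dB + \sum_(i < dB + dA) i)%N.
  rewrite !big_split_ord /= /w.
  under eq_bigr => i _ do rewrite (unsplitK (inl i)).
  under [X in (_ + X)%N]eq_bigr => i _ do rewrite (unsplitK (inr i)).
  by rewrite big_split /= sum_nat_const card_ord addnA [(dB * dA)%N]mulnC.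
rewrite /determinant rpred_sum // => s _.
have : ok (\sum_i w i)%N (\sum_i val (s i))%N (\prod_i S i (s i)).
  elim/big_rec3: _ => [|i x y z _ IH].
    by right; exists 0%N; rewrite dhomog1.
  case: (okS i (s i)) => [->|[c [ec hc]]]; first by left; rewrite mul0r.
  case: IH => [->|[c' [ec' hc']]]; first by left; rewrite mulr0.
  by right; exists (c + c')%N; rewrite dhomogM // addnACA ec ec'.
case=> [->|[c [ec hc]]]; first by rewrite mulr0 dhomog0.
have -> : (dA * dB)%N = c.
  apply/eqP; rewrite -(eqn_add2r (\sum_(i < dB + dA) i)) -sum_w -ec.
  by rewrite eqn_add2l [X in _ == X](reindex_inj (@perm_inj _ s)).
by rewrite -[_ ^+ _](rmorph_sign (@mpolyC n R)) mul_mpolyC dhomogZ.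
Qed.

(** A prime polynomial has no factor of smaller positive degree, so the gcd is
    associate to p over the field of fractions. *)
Lemma prime_dvd_gcd (p q : {poly R}) : prime_elt p -> (1 < size p)%N ->
  (1 < size (gcdp p q))%N -> divides p q.
Proof.
move=> [p0 pU pP] sp sG; set G := gcdp p q in sG.
have no_small (x : {poly R}) : x != 0 -> (size x < size p)%N -> ~ divides p x.
  move=> x0 lt [c e]; have c0 : c != 0 by apply: contraNneq x0 => c0; rewrite e c0 mul0r.
  move: lt; rewrite e size_mul // ltnNge.
  by rewrite (polySpred c0) addSn leq_addl.
have noC (c : R) : c != 0 -> ~ divides p c%:P.
  by move=> c0; apply: no_small; rewrite ?polyC_eq0 // size_polyC c0.
have /Pdiv.Idomain.dvdpP[[c g] /= c0 e] := dvdp_gcdl p q.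
have /Pdiv.Idomain.dvdpP[[c' g'] /= c'0 e'] := dvdp_gcdr p q.
have /andP[g0 G0] : (g != 0) && (G != 0).
  by rewrite -negb_or -mulf_eq0 -e -size_poly_eq0 size_scale // size_poly_eq0.
have sg : (size g < size p)%N.
  rewrite -(size_scale p c0) e size_mul // -(subnKC sG).
  by rewrite addnC !addSn /= ltnS leq_addl.
have: divides p (g * G) by rewrite -e -mul_polyC; exists c%:P.
case/pP => [/(no_small _ g0 sg)//|dG].
have: divides p (c'%:P * q) by rewrite mul_polyC e'; apply: dividesMl.
by case/pP => // /(noC _ c'0).
Qed.

End Resultant.

Lemma resultant_map (R S : nzRingType) (phi : {rmorphism R -> S}) (a b : {poly R}) :
  phi (lead_coef a) != 0 -> phi (lead_coef b) != 0 ->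
  phi (resultant a b) = resultant (map_poly phi a) (map_poly phi b).
Proof.
move=> a0 b0; rewrite /resultant /Sylvester_mx !size_map_poly_id0 //.
rewrite -det_map_mx /= map_col_mx; congr (\det (col_mx _ _));
  by apply: map_lin1_mx => v; rewrite map_poly_rV rmorphM /= map_rVpoly.
Qed.

Section Roots.
Variable F : fieldType.

(** Powers of distinct linear factors are coprime, so their product divides rho. *)
Lemma sum_mult_le_size (I : finType) (A : pred I) (t : I -> F) (w : I -> nat) (rho : {poly F}) :
  {in A &, injective t} -> rho != 0 ->
  (forall i, A i -> ('X - (t i)%:P) ^+ w i %| rho) ->
  (\sum_(i | A i) w i < size rho)%N.
Proof.
move=> inj_t rho0 dvd_t; rewrite -big_filter.
have : uniq (filter A (index_enum I)) by rewrite filter_uniq // index_enum_uniq.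
have : {subset filter A (index_enum I) <= A} by move=> i; rewrite mem_filter => /andP[].
move: (filter _ _) => s sA s_uniq.
suff [dvd_s <-] : \prod_(i <- s) ('X - (t i)%:P) ^+ w i %| rho /\
    size (\prod_(i <- s) ('X - (t i)%:P) ^+ w i) = (\sum_(i <- s) w i).+1.
  exact: dvdp_leq.
elim: s sA s_uniq => [|i s IH] sA; first by rewrite !big_nil dvd1p size_poly1.
move=> /= /andP[nis s_uniq].
have [||IH1 IH2] := IH; rewrite ?big_cons //.
  by move=> j js; apply: sA; rewrite inE js orbT.
have iA : i \in A by apply: sA; rewrite mem_head.
have XN0 : ('X - (t i)%:P) ^+ w i != 0 by rewrite expf_neq0 // polyXsubC_eq0.
have PN0 : \prod_(j <- s) ('X - (t j)%:P) ^+ w j != 0 by rewrite -size_poly_eq0 IH2.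
split; last by rewrite size_mul // IH2 size_exp_XsubC addSn addnS.
rewrite Gauss_dvdp ?dvd_t ?IH1 //.
apply: coprimep_expl; rewrite coprimep_sym coprimep_XsubC.
rewrite /root horner_prod prodf_seq_neq0; apply/allP => j js /=.
rewrite hornerE !hornerE expf_neq0 // subr_eq0.
apply: contraNneq nis => e; rewrite (inj_t i j) //.
by apply: sA; rewrite inE js orbT.
Qed.

End Roots.


(* Unifying two evaluations of different polynomials must not unfold these. *)
Opaque muni meval mmap along.

Section Elimination.
Variable K : closedFieldType.

Local Notation widen := (widen_ord (leqnSn 2)).

Definition ext_point (T : Type) (v : 'I_2 -> T) (z : T) (i : 'I_3) : T :=
  if unlift ord_max i is Some j then v j else z.

Lemma ext_point_widen T (v : 'I_2 -> T) z i : ext_point v z (widen i) = v i.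
Proof.
rewrite /ext_point (_ : widen i = lift ord_max i) ?liftK //.
by apply: val_inj; rewrite /= /bump leqNgt ltn_ord.
Qed.

Lemma ext_point_max T (v : 'I_2 -> T) z : ext_point v z ord_max = z.
Proof. by rewrite /ext_point unlift_none. Qed.

Lemma meval_muni (f : {mpoly K[3]}) (v : 'I_2 -> K) z :
  f.@[ext_point v z] = (map_poly (meval v) (muni f)).[z].
Proof.
rewrite (muni_morph (chi := meval v) (ev := horner_eval z)) // => [c|i|] /=.
- by rewrite !mevalC horner_evalE hornerC.
- by rewrite !mevalXU horner_evalE hornerC ext_point_widen.
- by rewrite mevalXU horner_evalE hornerX ext_point_max.
Qed.

Lemma along_muni (f : {mpoly K[3]}) (v w : 'I_2 -> K) z s :
  along (ext_point v z) (ext_point w s) f =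
    (map_poly (along v w) (muni f)).[z%:P + s *: 'X].
Proof.
rewrite (muni_morph (chi := along v w) (ev := horner_eval (z%:P + s *: 'X))) // => [c|i|] /=.
- by rewrite !alongC horner_evalE hornerC.
- by rewrite !alongX horner_evalE hornerC !ext_point_widen.
- by rewrite alongX horner_evalE hornerX !ext_point_max.
Qed.

(** The centre of the projection (x, y, z) |-> (x, y). *)
Definition pole : 'I_3 -> K := ext_point (fun=> 0) 1.

Section Form.
Variables (d : nat) (f : {mpoly K[3]}).
Hypotheses (hf : f \is d.-homog) (f_pole : f.@[pole] != 0).

(** Along the line from (v, 0) towards the pole, the coefficient of degree d is
    the value of f at the pole. *)
Lemma muni_top_coef v : ((muni f)`_d).@[v] = f.@[pole].
Proof.
have [_ <-] := along_homog (ext_point v 0) pole hf.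
rewrite along_muni polyC0 add0r scale1r.
have -> : map_poly (along v (fun=> 0)) (muni f) = map_poly (polyC \o meval v) (muni f).
  apply: eq_map_poly; apply: mpoly_morph_ext => [c|i] /=.
    by rewrite alongC mevalC.
  by rewrite alongX mevalXU scale0r addr0.
by rewrite map_poly_comp /= -/(comp_poly _ _) comp_polyXr coef_map.
Qed.

Lemma graded_muni : graded_coefs d (muni f).
Proof.
move=> k; case: leqP => [le|lt]; first exact: dhomog_muni_coef.
by rewrite (muni_coef_gt hf).
Qed.

Lemma size_muni : size (muni f) = d.+1.
Proof.
apply/anti_leq/andP; split.
  by apply/leq_sizeP => k lt; rewrite (muni_coef_gt hf).
rewrite ltnNge; apply: contraNN f_pole => le.
by rewrite -(muni_top_coef (fun=> 0)) nth_default // rmorph0.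
Qed.

Lemma lead_coef_muni v : (lead_coef (muni f)).@[v] = f.@[pole].
Proof. by rewrite lead_coefE size_muni muni_top_coef. Qed.

End Form.

Section TwoForms.
Variables (d e : nat) (f h : {mpoly K[3]}).
Hypotheses (hf : f \is d.-homog) (f_pole : f.@[pole] != 0).
Hypotheses (hh : h \is e.-homog) (h_pole : h.@[pole] != 0).

Definition eliminant := resultant (muni f) (muni h).

Lemma dhomog_eliminant : eliminant \is (d * e)%N.-homog.
Proof.
have sf := size_muni hf f_pole; have sh := size_muni hh h_pole.
exact: dhomog_resultant sf sh (graded_muni hf) (graded_muni hh).
Qed.

(** Since neither form vanishes at the pole, no degree drops under
    specialization, and the resultant of the specialized polynomials vanishes
    exactly when they have a common root. *)
Lemma eliminant_root v : eliminant.@[v] = 0 ->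
  exists z, f.@[ext_point v z] = 0 /\ h.@[ext_point v z] = 0.
Proof.
have -> : eliminant.@[v] =
    resultant (map_poly (meval v) (muni f)) (map_poly (meval v) (muni h)).
  apply: resultant_map; first by rewrite /= (lead_coef_muni hf).
  by rewrite /= (lead_coef_muni hh).
move=> /eqP; rewrite resultant_eq0 => gt1.
have : size (gcdp (map_poly (meval v) (muni f)) (map_poly (meval v) (muni h))) != 1%N.
  by rewrite gtn_eqF.
move=> /closed_rootP[z]; rewrite root_gcd => /andP[/rootP fz /rootP hz].
by exists z; split; rewrite meval_muni; [exact: fz|exact: hz].
Qed.

(** The eliminant is a combination of f and h, so it vanishes along the projected
    line at least to the order at which both f and h vanish along the line. *)
Lemma eliminant_along v w z s (D : {poly K}) : (0 < d)%N -> (0 < e)%N ->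
  D %| along (ext_point v z) (ext_point w s) f ->
  D %| along (ext_point v z) (ext_point w s) h -> D %| along v w eliminant.
Proof.
move=> d0 e0; rewrite !along_muni => Df Dh.
have [||[a b] /= _ e1] := @resultant_in_ideal _ (muni f) (muni h).
- by rewrite (size_muni hf).
- by rewrite (size_muni hh).
have -> : along v w eliminant =
    (map_poly (along v w) (a * muni f + b * muni h)).[z%:P + s *: 'X].
  by rewrite -e1 map_polyC hornerC.
move: (muni f) (muni h) Df Dh {e1} => F H Df Dh.
rewrite (rmorphD (map_poly (along v w))) !(rmorphM (map_poly (along v w))).
rewrite hornerD !hornerM; apply: dvdp_add; apply: dvdp_mull; [exact: Df|exact: Dh].
Qed.

(** Otherwise the prime f and h have a common factor. *)
Lemma eliminant_neq0 : (0 < d)%N -> prime_elt f -> ~ divides f h -> eliminant != 0.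
Proof.
move=> d0 fP ndvd; apply/eqP => /eqP; rewrite resultant_eq0 => gt1.
have mfP : prime_elt (muni f) by exact: (prime_iso (@muniK K 2) (@of_muniK K 2) fP).
have sf : (1 < size (muni f))%N by rewrite (size_muni hf).
have [c e1] := prime_dvd_gcd mfP sf gt1.
apply: ndvd; exists (of_muni c); apply: (can_inj (@muniK K 2)).
by rewrite muniM of_muniK; exact: e1.
Qed.

End TwoForms.

(** Either (0, 1) is a root, or the restriction to the affine line (1, T) has
    exact degree N, hence a root. *)
Lemma binary_form_root N (r : {mpoly K[2]}) : (0 < N)%N -> r \is N.-homog ->
  exists v, (exists i, v i != 0) /\ r.@[v] = 0.
Proof.
move=> N0 hr; pose e1 (i : 'I_2) : K := (i == 0)%:R; pose e2 (i : 'I_2) : K := (i == 1)%:R.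
have [sz top] := along_homog e1 e2 hr.
have [r0|r0] := eqVneq r.@[e2] 0.
  by exists e2; split=> //; exists 1; rewrite /e2 eqxx oner_neq0.
have : size (along e1 e2 r) != 1%N.
  rewrite gtn_eqF // (leq_trans (n := N.+1)) // ltnNge.
  by apply: contraNN r0 => le; rewrite -top nth_default.
move=> /closed_rootP[t /rootP]; rewrite horner_along => rt.
exists (fun i => e1 i + e2 i * t); split=> //; exists 0.
by rewrite /e1 /e2 eqxx mul0r addr0 oner_neq0.
Qed.

(** Dehomogenize: a zero of order w at (1, t) is a root t of order w of the
    polynomial r (1, T). *)
Lemma binary_form_mult_le N (r : {mpoly K[2]}) (I : finType) (A : pred I)
    (t : I -> K) (w : I -> nat) : r \is N.-homog -> r != 0 ->
  {in A &, injective t} ->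
  (forall i, A i -> 'X^(w i) %| along (fun k => if k == 0 then 1 else t i)
                                       (fun k => (k != 0)%:R) r) ->
  (\sum_(i | A i) w i <= N)%N.
Proof.
move=> hr r0 inj_t dvd_t.
pose e1 (i : 'I_2) : K := (i == 0)%:R; pose e2 (i : 'I_2) : K := (i != 0)%:R.
have [sz _] := along_homog e1 e2 hr.
rewrite -ltnS (leq_trans _ sz) //; apply: (sum_mult_le_size inj_t).
  have X0 : ('X_0 : {mpoly K[2]}) != 0.
    apply/eqP => /(congr1 (meval (fun=> 1))); rewrite mevalXU rmorph0.
    by apply/eqP; rewrite oner_eq0.
  have [v] := mpoly_neq0_eval (mulf_neq0 X0 r0).
  rewrite rmorphM /= mevalXU mulf_eq0 negb_or => /andP[v0 rv].
  apply: contraNneq rv => rho0.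
  have := horner_along e1 e2 r (v 1 / v 0); rewrite rho0 horner0 => e.
  rewrite (meval_homogZ (c := v 0) (v := fun k => e1 k + e2 k * (v 1 / v 0)) hr).
    by rewrite -e mulr0.
  move=> k; rewrite /e1 /e2; have [->|k0] := eqVneq k 0.
    by rewrite mul0r addr0 mulr1.
  rewrite mul1r add0r mulrC divfK //; congr v; apply: val_inj.
  by case: k k0 => [[|[|]]].
move=> i iA; have := dvdp_comp_poly ('X - (t i)%:P) (dvd_t i iA).
rewrite rmorphXn /= comp_polyX; congr (_ %| _).
move: r {hr r0 dvd_t sz}; apply: mpoly_ring_ind => [c|k|p q ep eq|p q ep eq].
- by rewrite !alongC comp_polyC.
- rewrite !alongX rmorphD /= comp_polyC comp_polyZ comp_polyX /e1 /e2.
  have [_|_] := eqVneq k 0; first by rewrite !scale0r !addr0.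
  by rewrite !scale1r polyC0 add0r addrC subrK.
- by rewrite !rmorphD /=; congr (_ + _).
- by rewrite !rmorphM /=; congr (_ * _).
Qed.

End Elimination.

(** * Two plane curves meet, and smooth curves are irreducible *)

(** A factor of a monomial in T is a monomial, since T is prime. *)
Lemma mul_monomialP (R : idomainType) (F G : {poly R}) c d : c != 0 -> F * G = c *: 'X^d ->
  exists a i, F = a *: 'X^i.
Proof.
elim: d F G => [|d IH] F G c0 e.
  have szFG : size (F * G) = 1%N by rewrite e expr0 alg_polyC size_polyC c0.
  have : F * G != 0 by rewrite -size_poly_eq0 szFG.
  rewrite mulf_eq0 negb_or => /andP[F0 G0].
  have : (size F <= 1)%N.
    by move: szFG; rewrite size_mul // (polySpred G0) addnS /= => <-; rewrite leq_addr.
  by move=> /size1_polyC eF; exists F`_0, 0%N; rewrite expr0 alg_polyC.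
have : root (F * G) 0 by rewrite /root e hornerZ hornerXn exprS mul0r mulr0.
have X0 : 'X != 0 :> {poly R} by rewrite polyX_eq0.
rewrite rootM => /orP[] /factor_theorem[H]; rewrite polyC0 subr0 => eH.
  have /IH[//|a [i ea]] : H * G = c *: 'X^d.
    by apply: (mulIf X0); rewrite mulrAC -eH e exprSr scalerAl.
  by exists a, i.+1; rewrite eH ea exprSr scalerAl.
apply: (IH F H) => //.
by apply: (mulIf X0); rewrite -mulrA -eH e exprSr scalerAl.
Qed.

Section HomogFactor.
Variable R : idomainType.

(** The substitution of X_i T for X_i, under which the homogeneous polynomials of
    degree d are those that become a multiple of T^d. *)
Definition grading n (p : {mpoly R[n]}) : {poly {mpoly R[n]}} :=
  mmap (@polyC _ \o @mpolyC n R) (fun i => 'X_i *: 'X) p.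

HB.instance Definition _ n := GRing.RMorphism.copy (@grading n)
  (mmap (@polyC _ \o @mpolyC n R) (fun i => 'X_i *: 'X)).

Lemma gradingX n (m : 'X_{1..n}) : grading 'X_[m] = 'X_[m] *: 'X^(mdeg m).
Proof.
rewrite /grading mmapX /mmap1 mdegE mpolyXE_id.
elim/big_rec3: _ => [|i x y z _ ->]; first by rewrite expr0 scale1r.
by rewrite exprZn -scalerAl -scalerAr scalerA exprD.
Qed.

Lemma grading_coef n (p : {mpoly R[n]}) k : (grading p)`_k = pihomog mdeg k p.
Proof.
rewrite pihomogE {1}[p]mpolyE rmorph_sum coef_sum [RHS]big_mkcond /=.
apply: eq_bigr => m _; rewrite -mul_mpolyC rmorphM /= gradingX.
rewrite {1}/grading mmapC /= coefCM coefZ coefXn [k == _]eq_sym mul_mpolyC.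
by case: (mdeg m == k); rewrite ?mulr1 ?mulr0 ?mul_mpolyC.
Qed.

Lemma grading_homog n d (p : {mpoly R[n]}) : p \is d.-homog -> grading p = p *: 'X^d.
Proof.
move=> hp; apply/polyP => k; rewrite grading_coef coefZ coefXn.
have [->|nk] := eqVneq k d; first by rewrite pihomog_dE // mulr1.
by rewrite mulr0 (pihomog_ne0 _ hp) // eq_sym.
Qed.

Lemma homog_factor n d (a b : {mpoly R[n]}) : a * b != 0 -> a * b \is d.-homog ->
  exists i, a \is i.-homog.
Proof.
move=> ab0 /grading_homog; rewrite rmorphM /= => e.
have [c [i ei]] := mul_monomialP ab0 e.
exists i; rewrite -[a](_ : pihomog mdeg i a = a) ?pihomogP //.
rewrite [RHS](pihomog_partitionE (leqnn (msize a))).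
have coefs k : pihomog mdeg k a = if k == i then c else 0.
  by rewrite -grading_coef ei coefZ coefXn; case: eqP; rewrite ?mulr1 ?mulr0.
rewrite coefs eqxx; under eq_bigr => k _ do rewrite coefs.
have [lt|ge] := ltnP i (msize a).
  rewrite (bigD1 (Ordinal lt)) //= eqxx big1 ?addr0 // => k /negPf.
  by rewrite -val_eqE /= => ->.
rewrite big1 => [|k _]; last by rewrite ltn_eqF // (leq_trans (ltn_ord k)).
have <- : pihomog mdeg i a = c by rewrite coefs eqxx.
rewrite pihomogE big1_seq // => m /andP[/eqP mi /msize_mdeg_lt]; rewrite mi ltnNge ge //.
Qed.

Lemma homog0_const n (p : {mpoly R[n]}) : p \is 0.-homog -> p = (p@_0)%:MP.
Proof.
move=> /dhomogP hp; apply: msize1_polyC; rewrite msizeE.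
by apply/bigmax_leqP_seq => m mp _; rewrite ltnS -(hp m mp).
Qed.

End HomogFactor.

Section Coordinates.
Variable K : closedFieldType.
Implicit Types (u v w P Q O : 'rV[K]_3) (p : {mpoly K[3]}).

Lemma ext_pointE (T : Type) (v : 'I_2 -> T) z :
  (ext_point v z o0 = v 0) * (ext_point v z o1 = v 1) * (ext_point v z o2 = z).
Proof.
have e2 : o2 = ord_max by apply: val_inj.
have e0 : o0 = widen_ord (leqnSn 2) 0 by apply: val_inj.
have e1 : o1 = widen_ord (leqnSn 2) 1 by apply: val_inj.
by rewrite e2 ext_point_max e0 e1 !ext_point_widen.
Qed.

Lemma mpoly_ext p q : (forall P, p.@[P 0] = q.@[P 0]) -> p = q.
Proof.
move=> e; apply/eqP; rewrite -subr_eq0; apply/negPn/negP => /mpoly_neq0_eval[v].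
by rewrite rmorphB /= -(meval_row p) -(meval_row q) e subrr eqxx.
Qed.

(** Row vectors P are coordinates with respect to the basis formed by the rows of
    M, so that p becomes the function P |-> p (P M). *)
Definition subst (M : 'M[K]_3) p := p \mPo [tuple \sum_j M j i *: 'X_j | i < 3].

HB.instance Definition _ M := GRing.RMorphism.copy (subst M)
  (comp_mpoly [tuple \sum_j M j i *: 'X_j | i < 3]).

Lemma meval_subst M p P : (subst M p).@[P 0] = p.@[(P *m M) 0].
Proof.
rewrite comp_mpoly_meval; apply: meval_eq => i.
rewrite tnth_mktuple rmorph_sum mxE; apply: eq_bigr => j _.
by rewrite /= mevalZ mevalXU mulrC.
Qed.

Lemma dhomog_subst d M p : p \is d.-homog -> subst M p \is d.-homog.
Proof.
move=> hp; rewrite -[d]muln1; apply: dhomog_comp => // i.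
rewrite tnth_mktuple rpred_sum // => j _.
by rewrite dhomogZ // dhomogX /= mdeg1.
Qed.

Lemma subst_comp M N p : subst N (subst M p) = subst (N *m M) p.
Proof. by apply: mpoly_ext => P; rewrite !meval_subst mulmxA. Qed.

Lemma subst1 p : subst 1%:M p = p.
Proof. by apply: mpoly_ext => P; rewrite meval_subst mulmx1. Qed.

Lemma substK M : M \in unitmx -> cancel (subst M) (subst (invmx M)).
Proof. by move=> MU p; rewrite subst_comp mulVmx // subst1. Qed.

Lemma substVK M : M \in unitmx -> cancel (subst (invmx M)) (subst M).
Proof. by move=> MU p; rewrite subst_comp mulmxV // subst1. Qed.

Lemma along_subst M p v w :
  along (v 0) (w 0) (subst M p) = along ((v *m M) 0) ((w *m M) 0) p.
Proof.
move: p; apply: mpoly_ring_ind => [c|i|p q ep eq|p q ep eq].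
- by rewrite /subst comp_mpolyC !alongC.
- rewrite /subst comp_mpolyXU -tnth_nth tnth_mktuple alongX rmorph_sum /= !mxE.
  rewrite rmorph_sum scaler_suml -big_split /=; apply: eq_bigr => j _.
  rewrite -mul_mpolyC rmorphM /= alongC alongX mulrDr -!polyCM -mul_polyC mulrA -polyCM.
  by rewrite mul_polyC ![M j i * _]mulrC.
- by rewrite !rmorphD /=; congr (_ + _); [exact: ep|exact: eq].
- by rewrite !rmorphM /=; congr (_ * _); [exact: ep|exact: eq].
Qed.

Definition basis_mx u v w : 'M[K]_3 := \matrix_(i, j) (nth 0 [:: u; v; w] i) 0 j.

Lemma mul_basis_mx u v w P :
  P *m basis_mx u v w = P 0 o0 *: u + P 0 o1 *: v + P 0 o2 *: w.
Proof. by apply/rowP => i; rewrite !mxE sum3 !mxE /=. Qed.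

(** The inverse matrix is the transpose of the matrix of pairwise cross products,
    up to the determinant dot (cross u v) w. *)
Lemma basis_mx_unit u v w : dot (cross u v) w != 0 -> basis_mx u v w \in unitmx.
Proof.
set D := dot _ _ => D0.
pose N := D^-1 *: (basis_mx (cross v w) (cross w u) (cross u v))^T.
suff /mulmx1_unit[] : basis_mx u v w *m N = 1%:M by [].
rewrite -scalemxAr; apply/matrixP => i j; rewrite !mxE sum3 !mxE.
have -> : (i == j)%:R = D^-1 * (D *+ (i == j)) by rewrite mulrnAr mulVf.
congr (_ * _); rewrite /D dotE.
by have [] := ord3P i => ->; have [] := ord3P j => -> /=;
  rewrite ?row3E -?val_eqE /= ?mulr1n ?mulr0n; ring.
Qed.

Lemma exists_cross_neq0 u : u != 0 -> exists v, cross u v != 0.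
Proof.
move=> u0; apply: NNPP => no.
have all0 v : cross u v = 0 by apply/eqP/negPn/negP => h; apply: no; exists v.
case/negP: u0; apply/eqP.
have e1 := all0 (row3 1 0 0); have e2 := all0 (row3 0 1 0).
move/rowP: e1 => e1; move/rowP: e2 => e2.
apply: row3P; rewrite mxE.
- by have := e2 o2; rewrite /cross !row3E mxE => <-; ring.
- by have := e1 o2; rewrite /cross !row3E mxE => /eqP; rewrite mulr0 mulr1 sub0r oppr_eq0 => /eqP.
- by have := e1 o1; rewrite /cross !row3E mxE => <-; ring.
Qed.

(** Project from a point O on neither curve: the eliminant is a binary form of
    positive degree, and over one of its roots the two curves meet. *)
Theorem plane_curves_meet (a b : {mpoly K[3]}) m n :
  a != 0 -> b != 0 -> a \is m.-homog -> b \is n.-homog -> (0 < m)%N -> (0 < n)%N ->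
  exists P, [/\ P != 0, a.@[P 0] = 0 & b.@[P 0] = 0].
Proof.
move=> a0 b0 ha hb m0 n0.
have [||O [abO Oe]] := @generic_point K (a * b) [:: row3 1 0 0].
- exact: mulf_neq0.
- by move=> w; rewrite inE => /eqP->; exact: row3_100_neq0.
have O0 : O != 0.
  by have := Oe _ (mem_head _ _); apply: contraNneq => ->; rewrite dot0r.
have [v] := exists_cross_neq0 O0; rewrite cross_eq0C => /dot_neq0[u].
rewrite dotC -dot_crossA => D0.
have MU := basis_mx_unit D0; set M := basis_mx u v O in MU.
move: abO; rewrite rmorphM mulf_eq0 negb_or => /andP[aO bO].
have poleM p : (subst M p).@[pole K] = p.@[O 0].
  rewrite -meval_row meval_subst mul_basis_mx !mxE /pole !ext_pointE.
  by rewrite !scale0r scale1r !add0r.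
have ha' := dhomog_subst M ha; have hb' := dhomog_subst M hb.
have aP : (subst M a).@[pole K] != 0 by rewrite poleM.
have bP : (subst M b).@[pole K] != 0 by rewrite poleM.
have mn0 : (0 < m * n)%N by rewrite muln_gt0 m0.
have [t [[i ti] rt]] := binary_form_root mn0 (dhomog_eliminant ha' aP hb' bP).
have [z [az bz]] := eliminant_root ha' aP hb' bP rt.
exists ((\row_j ext_point t z j) *m M); split.
- apply: contraNneq ti => /(congr1 (mulmx^~ (invmx M))).
  rewrite mulmxK // mul0mx => /rowP/(_ (widen_ord (leqnSn 2) i)).
  by rewrite !mxE ext_point_widen => ->.
- by rewrite -meval_subst meval_row; exact: az.
- by rewrite -meval_subst meval_row; exact: bz.
Qed.

(** Let a be a prime factor of f, with cofactor b.  If b is not constant, then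
    the curves a = 0 and b = 0 meet, and at a common point both terms of the
    product rule vanish, so that f is singular there. *)
Theorem smooth_curve_prime (f : {mpoly K[3]}) d :
  (0 < d)%N -> f != 0 -> f \is d.-homog -> smooth_curve f -> prime_elt f.
Proof.
move=> d0 f0 hf smooth_f.
have const_unit p : p != 0 -> p \is 0.-homog -> p \is a GRing.unit.
  move=> p0 /homog0_const e; apply/andP; split; first by rewrite -e.
  by rewrite unitfE; apply: contraNneq p0 => h; rewrite e h mpolyC0.
have [u [s [uU sP ef]]] := @factorial_mpoly K 3 f f0.
case: s => [|a s] in sP ef.
  have /andP[/eqP eu _] : u \is a GRing.unit by [].
  have h0 : f \is 0.-homog.
    by rewrite ef big_nil mulr1 eu -alg_mpolyC dhomogZ // dhomog1.
  by rewrite (dhomog_uniq f0 hf h0) in d0.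
move/prime_seq_cons: sP => [aP sP].
rewrite big_cons mulrCA in ef; set b := u * _ in ef; clearbody b.
have fab : a * b != 0 by rewrite -ef.
have hfab : a * b \is d.-homog by rewrite -ef.
have [i ha] := homog_factor fab hfab.
have [j hb] : exists j, b \is j.-homog by apply: (@homog_factor _ _ d b a); rewrite mulrC.
have /andP[a0 b0] : (a != 0) && (b != 0) by rewrite -negb_or -mulf_eq0.
have i0 : (0 < i)%N.
  rewrite lt0n; apply/eqP => i0; have [_ /negP aU _] := aP.
  by apply: aU; apply: const_unit => //; rewrite i0 in ha.
have [j0|j0] := posnP j.
  have bU : b \is a GRing.unit by apply: const_unit => //; rewrite j0 in hb.
  rewrite ef; have [_ aU aPP] := aP; split=> //; first by rewrite unitrM bU andbT.
  have dvdE x : divides (a * b) x <-> divides a x.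
    split=> [[c ->]|[c ->]]; first by exists (c * b); rewrite mulrAC mulrA.
    by exists (c / b); rewrite [a * b]mulrC mulrA divrK.
  by move=> x y /dvdE/aPP[]/dvdE; [left|right].
have [P [P0 aP0 bP0]] := plane_curves_meet a0 b0 ha hb i0 j0.
have [] := smooth_f P; first by split; rewrite // ef rmorphM /= aP0 mul0r.
move=> _ /negP[]; apply/eqP/rowP => k; rewrite !mxE ef mderivM.
by rewrite rmorphD !rmorphM /= aP0 bP0 mulr0 mul0r addr0.
Qed.

End Coordinates.

(** * Bezout's inequality and the Nullstellensatz *)

Section Bezout.
Variable K : closedFieldType.
Implicit Types (u v w P Q O : 'rV[K]_3) (f h p : {mpoly K[3]}).

Lemma euler_eval d f P : f \is d.-homog -> dot P (gradient f P) = f.@[P 0] *+ d.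
Proof.
move=> hf; rewrite -rmorphMn /= -(euler hf) rmorph_sum; apply: eq_bigr => i _.
by rewrite rmorphM /= mevalXU mxE.
Qed.

Lemma gradientZ d f (c : K) P : f \is d.-homog ->
  gradient f (c *: P) = c ^+ d.-1 *: gradient f P.
Proof.
move=> hf; apply/rowP => i; rewrite !mxE.
apply: (meval_homogZ (dhomog_mderiv i hf)) => j; by rewrite mxE.
Qed.

Lemma meval_scale d f (c : K) P : f \is d.-homog -> f.@[(c *: P) 0] = c ^+ d * f.@[P 0].
Proof. by move=> hf; apply: (meval_homogZ hf) => i; rewrite mxE. Qed.

Lemma along_coef1E f P v : (along (P 0) (v 0) f)`_1 = dot v (gradient f P).
Proof. by rewrite along_coef1; apply: eq_bigr => i _; rewrite mxE. Qed.

Lemma dvdp_X1 (p : {poly K}) : p`_0 = 0 -> 'X^1 %| p.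
Proof.
by move=> e; rewrite expr1 -['X]subr0 -polyC0 dvdp_XsubCl /root horner_coef0 e.
Qed.

Lemma dvdp_X2 (p : {poly K}) : p`_0 = 0 -> p`_1 = 0 -> 'X^2 %| p.
Proof.
move=> /dvdp_X1/dvdpP[q ->]; rewrite expr1 coefMX /= => e.
by rewrite exprS mulrC dvdp_mul // dvdp_X1.
Qed.

Lemma tangent_along d f P w (b : bool) (a : K) : f \is d.-homog -> f.@[P 0] = 0 ->
  (b -> dot w (gradient f P) = 0) -> 'X^(b.+1) %| along ((a *: P) 0) (w 0) f.
Proof.
move=> hf fP fw.
have e0 : (along ((a *: P) 0) (w 0) f)`_0 = 0.
  by rewrite along_coef0 (meval_scale _ _ hf) fP mulr0.
case: b fw => [/(_ isT) fw|_]; last exact: dvdp_X1.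
apply: dvdp_X2 => //.
by rewrite along_coef1E (gradientZ _ _ hf) dotZr fw mulr0.
Qed.

Lemma along_eq n (v v' w w' : 'I_n -> K) (p : {mpoly K[n]}) :
  v =1 v' -> w =1 w' -> along v w p = along v' w' p.
Proof.
move=> ev ew; move: p; apply: mpoly_ring_ind => [c|i|p q ep eq|p q ep eq].
- by rewrite !alongC.
- by rewrite !alongX ev ew.
- by rewrite !rmorphD /=; congr (_ + _); [exact: ep|exact: eq].
- by rewrite !rmorphM /=; congr (_ * _); [exact: ep|exact: eq].
Qed.

(** Each common point P i of f and h counts once, and twice if f and h have the
    common tangent direction v i there.  Project from a point O chosen off both
    curves, off the chords through the points and off the tangent lines at the
    double ones.  The points then have distinct images, the tangent directions
    are not contracted, and the eliminant vanishes at each image to the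
    prescribed order. *)
Theorem weighted_bezout f h d e (I : finType) (A : {pred I})
    (P v : I -> 'rV[K]_3) (b : I -> bool) :
  prime_elt f -> (0 < d)%N -> f \is d.-homog -> h \is e.-homog -> ~ divides f h ->
  (forall i, i \in A -> [/\ P i != 0, f.@[P i 0] = 0 & h.@[P i 0] = 0]) ->
  {in A &, forall i j, cross (P i) (P j) = 0 -> i = j} ->
  (forall i, i \in A -> b i -> [/\ cross (P i) (v i) != 0,
      dot (v i) (gradient f (P i)) = 0 & dot (v i) (gradient h (P i)) = 0]) ->
  (\sum_(i in A) (b i).+1 <= d * e)%N.
Proof.
move=> fP d0 hf hh ndvd onP injP tanP.
have [i0 i0A|A0] := pickP (mem A); last by rewrite big_pred0.
have f0 : f != 0 by have [] := fP.
have h0 : h != 0 by apply/eqP => h0; apply: ndvd; exists 0; rewrite h0 mul0r.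
have e0 : (0 < e)%N.
  rewrite lt0n; apply/eqP => e0; move: hh; rewrite e0 => /homog0_const eh.
  have [_ _] := onP _ i0A; rewrite eh mevalC => c0.
  by case/eqP: h0; rewrite eh c0 mpolyC0.
pose ws := [seq cross (P x.1) (P x.2) | x <- enum [pred x : I * I | [&& x.1 \in A, x.2 \in A & x.1 != x.2]]]
  ++ [seq cross (P i) (v i) | i <- enum [pred i | (i \in A) && b i]].
have ws0 w : w \in ws -> w != 0.
  rewrite mem_cat => /orP[] /mapP[x]; rewrite mem_enum inE.
    move=> /and3P[x1 x2 nx] ->; apply: contraNneq nx => ex.
    by rewrite (injP _ _ x1 x2 ex).
  by move=> /andP[xA bx] ->; have [] := tanP x xA bx.
have [O [fhO wsO]] := generic_point (mulf_neq0 f0 h0) ws0.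
move: fhO; rewrite rmorphM /= mulf_eq0 negb_or => /andP[fO hO].
have chordO i j : i \in A -> j \in A -> i != j -> dot (cross (P i) (P j)) O != 0.
  move=> iA jA nij; apply: wsO; rewrite mem_cat; apply/orP; left.
  by apply/mapP; exists (i, j); rewrite // mem_enum inE /= iA jA.
have tangentO i : i \in A -> b i -> dot (cross (P i) (v i)) O != 0.
  move=> iA bi; apply: wsO; rewrite mem_cat; apply/orP; right.
  by apply/mapP; exists i; rewrite // mem_enum inE /= iA.
pose us := [seq cross (P i) O | i <- enum A].
have us0 u : u \in us -> u != 0.
  move=> /mapP[i]; rewrite mem_enum => iA ->; have [Pi0 fPi _] := onP i iA.
  apply: contraNneq fO => /(cross_eq0P Pi0)[c ->].
  by rewrite (meval_scale _ _ hf) fPi mulr0.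
(* E is chosen so that the first coordinate of each point is nonzero in the
   basis P i0, E, O; each point is then scaled to (1, t, z). *)
have [E [_ usE]] := generic_point (oner_neq0 _) us0.
have fibreE i : i \in A -> dot (cross (P i) O) E != 0.
  by move=> iA; apply: usE; apply/mapP; exists i; rewrite ?mem_enum.
have D0 : dot (cross (P i0) E) O != 0.
  by rewrite dot_crossA crossC dotC -scaleN1r dotZl mulN1r oppr_eq0 dotC -dot_crossA fibreE.
have MU := basis_mx_unit D0; set M := basis_mx _ _ _ in MU.
pose Q i := P i *m invmx M; pose W i := v i *m invmx M.
have QM i : Q i *m M = P i by rewrite mulmxKV.
have WM i : W i *m M = v i by rewrite mulmxKV.
have Q0 i : i \in A -> Q i 0 o0 != 0.
  move=> iA; apply: contraNneq (fibreE i iA) => q0.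
  rewrite -(QM i) mul_basis_mx q0 scale0r add0r; apply/eqP; cross_ring.
pose t i := Q i 0 o1 / Q i 0 o0; pose z i := Q i 0 o2 / Q i 0 o0.
have QE i : i \in A -> (Q i 0 o0)^-1 *: Q i = row3 1 (t i) (z i).
  by move=> /Q0 q0; apply: row3P; rewrite row3E mxE ?mulVf // mulrC.
have QEM i : i \in A -> row3 1 (t i) (z i) *m M = (Q i 0 o0)^-1 *: P i.
  by move=> /QE <-; rewrite -scalemxAl QM.
have row3M c : row3 0 0 c *m M = c *: O.
  by rewrite mul_basis_mx !row3E !scale0r !add0r.
have inj_t : {in A &, injective t}.
  move=> i j iA jA etij; apply/eqP/negPn/negP => nij.
  have cO := chordO i j iA jA nij.
  have := row3M (z i - z j).
  have -> : row3 0 0 (z i - z j) = row3 1 (t i) (z i) - row3 1 (t j) (z j).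
    by apply: row3P; rewrite [RHS]mxE [X in _ = _ + X]mxE !row3E ?etij ?subrr.
  rewrite mulmxBl !QEM // => /(congr1 (dot (cross (P i) (P j)))).
  rewrite -scaleN1r !dotDr !dotZr ![dot (cross _ _) (P _)]dotC.
  rewrite dot_cross_l dot_cross_r !mulr0 addr0.
  move=> /esym/eqP; rewrite mulf_eq0 (negPf cO) orbF subr_eq0 => /eqP ez.
  have := QEM i iA; rewrite etij ez QEM // => /(congr1 (cross (P i))).
  rewrite !crossZr crossvv scaler0 => /eqP; rewrite scaler_eq0 invr_eq0.
  rewrite (negPf (Q0 j jA)) /= => /eqP ePP.
  by move: cO; rewrite ePP dotC dot0r eqxx.
(* A tangent direction may be changed by a multiple of the point, which makes
   its first coordinate zero, and scaled; O being off the tangent line, its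
   second coordinate can be made 1. *)
have dirP i : i \in A -> exists w s, [/\ w = row3 0 1 s *m M,
    b i -> dot w (gradient f (P i)) = 0 & b i -> dot w (gradient h (P i)) = 0].
  move=> iA; case bi: (b i); last by exists (row3 0 1 0 *m M), 0.
  have [Pv0 fv hv] := tanP i iA bi; have [Pi0 fPi hPi] := onP i iA.
  have tO := tangentO i iA bi.
  pose c := - (W i 0 o0 / Q i 0 o0).
  have eW : (W i + c *: Q i) 0 o0 = 0 by rewrite mxE [X in _ + X]mxE /c mulNr divfK ?Q0 // subrr.
  set y := (W i + c *: Q i) 0 o1; pose s := (W i + c *: Q i) 0 o2.
  have y0 : y != 0.
    apply/eqP => y0; have := row3M s.
    have -> : row3 0 0 s = W i + c *: Q i by apply: row3P; rewrite row3E ?eW -?y0.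
    rewrite mulmxDl -scalemxAl WM QM => evP.
    have := congr1 (dot (cross (P i) (v i))) evP.
    rewrite dotDr !dotZr ![dot (cross _ _) _]dotC dot_cross_l dot_cross_r mulr0 addr0.
    move=> /esym/eqP; rewrite mulf_eq0 dotC (negPf tO) orbF => /eqP s0.
    move: evP; rewrite s0 scale0r => /(congr1 (cross (P i))).
    rewrite crossDr crossZr crossvv scaler0 addr0 cross0r => e1.
    by rewrite e1 eqxx in Pv0.
  exists (y^-1 *: (v i + c *: P i)), (s / y); split.
  - rewrite -{1}(WM i) -{1}(QM i) scalemxAl -mulmxDl scalemxAl; congr (_ *m _).
    apply: row3P; rewrite row3E mxE ?eW ?mulr0 ?mulVf //.
    by rewrite mulrC.
  - rewrite dotZl dotC dotDr dotZr dotC fv dotC (euler_eval _ hf) fPi mul0rn.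
    by rewrite mulr0 addr0 mulr0.
  - rewrite dotZl dotC dotDr dotZr dotC hv dotC (euler_eval _ hh) hPi mul0rn.
    by rewrite mulr0 addr0 mulr0.
have poleM p : (subst M p).@[pole K] = p.@[O 0].
  rewrite -meval_row meval_subst mul_basis_mx !mxE /pole !ext_pointE.
  by rewrite !scale0r scale1r !add0r.
have hf' := dhomog_subst M hf; have hh' := dhomog_subst M hh.
have fO' : (subst M f).@[pole K] != 0 by rewrite poleM.
have hO' : (subst M h).@[pole K] != 0 by rewrite poleM.
have fP' : prime_elt (subst M f) by exact: (prime_iso (substK MU) (substVK MU) fP).
have ndvd' : ~ divides (subst M f) (subst M h).
  move=> [c ec]; apply: ndvd; exists (subst (invmx M) c).
  by apply: (can_inj (substK MU)); rewrite rmorphM /= substVK.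
have r0 := eliminant_neq0 hf' fO' d0 fP' ndvd'.
have hr := dhomog_eliminant hf' fO' hh' hO'.
apply: (binary_form_mult_le hr r0 inj_t) => i iA.
have [w [s [ew fw hw]]] := dirP i iA; have [Pi0 fPi hPi] := onP i iA.
have dvd_along p n : p \is n.-homog -> p.@[P i 0] = 0 ->
    (b i -> dot w (gradient p (P i)) = 0) ->
    'X^((b i).+1) %| along (ext_point (fun k => if k == 0 then 1 else t i) (z i))
        (ext_point (fun k => (k != 0)%:R) s) (subst M p).
  move=> hp pP pw; have := tangent_along (Q i 0 o0)^-1 hp pP pw.
  rewrite ew -QEM // -along_subst; congr (_ %| _).
  by apply: along_eq => k; have [] := ord3P k => ->; rewrite row3E ext_pointE.
apply: (eliminant_along hf' fO' hh' hO' d0 e0 (z := z i) (s := s)).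
  exact: (dvd_along _ _ hf).
exact: (dvd_along _ _ hh).
Qed.

(** A line avoiding the points found so far still meets the curve. *)
Lemma curve_many_points f d N : f != 0 -> f \is d.-homog -> (0 < d)%N ->
  exists s : seq 'rV[K]_3, [/\ size s = N,
    forall P, P \in s -> P != 0 /\ f.@[P 0] = 0
    & pairwise (fun P Q => cross P Q != 0) s].
Proof.
move=> f0 hf d0; elim: N => [|N [s [ss sP sD]]]; first by exists [::].
pose ws := row3 1 0 0 :: s.
have ws0 P : P \in ws -> P != 0.
  by rewrite inE => /orP[/eqP->|/sP[]//]; exact: row3_100_neq0.
have [l [_ lP]] := generic_point (oner_neq0 _) ws0.
have l0 : l != 0.
  by have := lP _ (mem_head _ _); apply: contraNneq => ->; rewrite dot0r.
have [P [P0 fP]] := plane_curves_meet f0 (linear_form_neq0 l0) hf (dhomog_linear_form l) d0 isT.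
rewrite meval_linear_form => lP0; exists (P :: s); split.
- by rewrite /= ss.
- by move=> R; rewrite inE => /orP[/eqP->|/sP].
rewrite /= sD andbT; apply/allP => R Rs; apply/eqP => /(cross_eq0P P0)[c eR].
have := lP R; rewrite inE Rs orbT eR dotC dotZr lP0 mulr0 eqxx.
by move=> /(_ isT).
Qed.

(** A form which f does not divide has at most d e zeros on the curve, which has
    more points than that. *)
Theorem nullstellensatz f d h e : prime_elt f -> (0 < d)%N -> f \is d.-homog ->
  h \is e.-homog -> (forall P, zero_locus f P -> h.@[P 0] = 0) -> divides f h.
Proof.
move=> fP d0 hf hh van; apply: NNPP => ndvd.
have f0 : f != 0 by have [] := fP.
have [s [ss sP sD]] := curve_many_points (d * e).+1 f0 hf d0.
pose P (i : 'I_(d * e).+1) := nth 0 s i.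
have Ps i : P i \in s by rewrite mem_nth // ss.
have cross0 i j : cross (P i) (P j) = 0 -> i = j.
  have lt_neq0 (k l : 'I_(d * e).+1) : (k < l)%N -> cross (P k) (P l) != 0.
    have kin : val k \in gtn (size s) by rewrite unfold_in /= ss; exact: ltn_ord.
    have lin : val l \in gtn (size s) by rewrite unfold_in /= ss; exact: ltn_ord.
    exact: (elimT (pairwiseP 0) sD _ _ kin lin).
  move=> e0; apply: val_inj; case: (ltngtP (val i) (val j)) => // /lt_neq0.
    by rewrite e0 eqxx.
  by rewrite cross_eq0C e0 eqxx.
suff H : ((d * e).+1 <= d * e)%N by rewrite ltnn in H.
rewrite -[X in (X <= _)%N](card_ord (d * e).+1) -sum1_card.
apply: (@weighted_bezout f h d e _ predT P P (fun=> false) fP d0 hf hh ndvd) =>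
  [i _|i j _ _|//]; last exact: cross0.
have [P0 fPi] := sP _ (Ps i); split=> //; exact: van.
Qed.

Lemma exists_not_zero f d h e : prime_elt f -> (0 < d)%N -> f \is d.-homog ->
  h \is e.-homog -> ~ divides f h -> exists2 P, zero_locus f P & h.@[P 0] != 0.
Proof.
move=> fP d0 hf hh ndvd; apply: NNPP => no; apply: ndvd.
apply: (nullstellensatz fP d0 hf hh) => P zP.
by apply/eqP/negPn/negP => hP; apply: no; exists P.
Qed.

End Bezout.

(** * Lines without tangency are transverse *)

Section Transversality.
Variable K : closedFieldType.
Implicit Types (u v w P Q L : 'rV[K]_3) (f : {mpoly K[3]}).

(** The plane orthogonal to L is spanned by cross products with L; as L may be
    isotropic, the two factors have to be chosen in general position. *)
Lemma line_basis L : L != 0 -> exists A1 A2 c,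
  [/\ c != 0, cross A1 A2 = c *: L &
      forall Q, dot Q L = 0 -> exists a b, Q = a *: A1 + b *: A2].
Proof.
move=> L0; have [u /dot_neq0[w c0]] := exists_cross_neq0 L0.
pose A1 := cross L u; pose A2 := cross L w; set c := dot _ _ in c0.
have cA : cross A1 A2 = c *: L by rewrite /c; cross_ring.
have [N LN] := dot_neq0 L0.
have D0 : dot (cross A1 A2) N != 0 by rewrite cA dotZl mulf_neq0.
have MU := basis_mx_unit D0.
exists A1, A2, c; split=> // Q QL.
pose X := Q *m invmx (basis_mx A1 A2 N).
have eQ : Q = X 0 o0 *: A1 + X 0 o1 *: A2 + X 0 o2 *: N.
  by rewrite -mul_basis_mx mulmxKV.
exists (X 0 o0), (X 0 o1); rewrite {1}eQ.
suff -> : X 0 o2 = 0 by rewrite scale0r addr0.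
move: QL; rewrite dotC eQ !dotDr !dotZr !dot_cross_l !mulr0 !add0r => /eqP.
by rewrite mulf_eq0 (negPf LN) orbF => /eqP.
Qed.

Lemma horner_along_row f P Q x : (along (P 0) (Q 0) f).[x] = f.@[(P + x *: Q) 0].
Proof. by rewrite horner_along; apply: meval_eq => i; rewrite !mxE mulrC. Qed.

Lemma deriv_along_row f P Q x :
  (along (P 0) (Q 0) f)^`().[x] = dot Q (gradient f (P + x *: Q)).
Proof.
rewrite deriv_along horner_sum; apply: eq_bigr => i _.
by rewrite hornerZ horner_along_row !mxE.
Qed.

(** The gradient at P is orthogonal to P by the Euler relation. *)
Lemma tangent_line_gradient f d P u v c L : f \is d.-homog -> f.@[P 0] = 0 ->
  c != 0 -> cross P v = c *: L -> dot v (gradient f P) = 0 -> cross (gradient f P) L = 0.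
Proof.
move=> hf fP c0 ePv fv; have := euler_eval P hf; rewrite fP mul0rn => fPP.
have := double_cross (gradient f P) P v.
rewrite ePv crossZr [dot _ v]dotC [dot _ P]dotC fv fPP !scale0r subrr => /eqP.
by rewrite scaler_eq0 (negPf c0) => /eqP.
Qed.

(** On the line through A2 and a point B off the curve, f restricts to a
    polynomial of exact degree d, and a double root of it would be a point of
    tangency. *)
Theorem transverse_of_not_tangent f d L : (0 < d)%N -> f \is d.-homog -> L != 0 ->
  (forall P, zero_locus f P -> dot P L = 0 -> cross (gradient f P) L != 0) ->
  transverse d f L.
Proof.
move=> d0 hf L0 ntan; have [A1 [A2 [c [c0 eA spanA]]]] := line_basis L0.
have onL P v c' : c' != 0 -> cross P v = c' *: L -> P != 0 /\ dot P L = 0.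
  move=> c'0 e; split.
    apply: contraNneq L0 => P0; move: e; rewrite P0 crossC cross0r oppr0 => /esym/eqP.
    by rewrite scaler_eq0 (negPf c'0).
  have := dot_cross_l P v; rewrite e dotZr => /eqP.
  by rewrite mulf_eq0 (negPf c'0) => /eqP.
have no_tan P v c' : c' != 0 -> cross P v = c' *: L -> f.@[P 0] = 0 ->
    dot v (gradient f P) != 0.
  move=> c'0 e fP; have [P0 PL] := onL _ _ _ c'0 e; have := ntan P (conj P0 fP) PL.
  apply: contraNneq => fv; apply/eqP; exact: (tangent_line_gradient _ hf fP c'0 e fv).
have [x fB] : exists x, f.@[(A1 + x *: A2) 0] != 0.
  have : along (A1 0) (A2 0) f != 0.
    apply/eqP => e; have fA1 : f.@[A1 0] = 0 by rewrite -(along_coef0 _ (A2 0)) e coef0.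
    by have := no_tan _ _ _ c0 eA fA1; rewrite -along_coef1E e coef0 eqxx.
  by move=> /closed_nonrootP[x]; rewrite /root horner_along_row; exists x.
set B := A1 + x *: A2 in fB.
have eAB : cross A2 B = (- c) *: L.
  by rewrite crossDr crossZr crossvv scaler0 addr0 crossC eA scaleNr.
have nc0 : - c != 0 by rewrite oppr_eq0.
have crossPB t : cross (A2 + t *: B) B = (- c) *: L.
  by rewrite -eAB crossC crossDr crossZr crossvv scaler0 addr0 -crossC.
have spanB Q : dot Q L = 0 -> exists a b, Q = a *: A2 + b *: B.
  move=> /spanA[a [b ->]]; exists (b - a * x), a.
  by apply/rowP => i; rewrite /B !mxE; ring.
pose phi := along (A2 0) (B 0) f.
have [sz top] := along_homog (A2 0) (B 0) hf.
have szphi : size phi = d.+1.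
  apply/anti_leq; rewrite sz /= ltnNge; apply: contraNN fB => le.
  by rewrite -top nth_default.
have phi0 : phi != 0 by rewrite -size_poly_eq0 szphi.
have [r er] := closed_field_poly_normal phi.
have lc0 : lead_coef phi != 0 by rewrite lead_coef_eq0.
have szr : size r = d.
  by apply/eqP; rewrite -eqSS -szphi er size_scale // size_prod_XsubC.
have rootr t : (t \in r) = (f.@[(A2 + t *: B) 0] == 0).
  by rewrite -horner_along_row -/phi -root_prod_XsubC -rootE er rootZ.
have uniq_r : uniq r.
  rewrite -separable_prod_XsubC separable_poly.unlock.
  rewrite -(coprimepZl _ _ lc0) -(coprimepZr _ _ lc0) -derivZ -er.
  rewrite /coprimep; apply/negPn/negP => /closed_rootP[t].
  rewrite root_gcd => /andP[/rootP ft /rootP]; rewrite deriv_along_row; apply/eqP.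
  by apply: (no_tan _ _ _ nc0 (crossPB t)); rewrite -horner_along_row.
pose R (i : 'I_d) := A2 + r`_i *: B.
have R0 i : R i != 0 by have [] := onL _ _ _ nc0 (crossPB r`_i).
have RL i : dot (R i) L = 0 by have [] := onL _ _ _ nc0 (crossPB r`_i).
have fR i : f.@[(R i) 0] = 0 by apply/eqP; rewrite -rootr mem_nth // szr.
exists R; split=> [i j|Q].
  move=> /(eq_pointP (R0 i) (R0 j)).
  have -> : cross (R i) (R j) = (r`_j - r`_i) *: cross A2 B by rewrite /R; cross_ring.
  rewrite eAB scalerA => /eqP; rewrite scaler_eq0 (negPf L0) orbF mulf_eq0 (negPf nc0) orbF.
  rewrite subr_eq0 nth_uniq ?szr // => /eqP e; apply: val_inj; exact: esym.
split=> [[[Q0 fQ] [_ /mulmx_tr_eq0 QL]]|[i eQ]].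
  have [a [b eQ]] := spanB Q QL.
  have a0 : a != 0.
    apply: contraNneq Q0 => a0; move: fQ; rewrite eQ a0 scale0r add0r (meval_scale _ _ hf).
    by move=> /eqP; rewrite mulf_eq0 (negPf fB) orbF expf_eq0 d0 => /eqP ->; rewrite scale0r.
  have eQ' : Q = a *: (A2 + (b / a) *: B) by rewrite scalerDr scalerA mulrC divfK.
  have : b / a \in r.
    rewrite rootr; move: fQ; rewrite eQ' (meval_scale _ _ hf) => /eqP.
    by rewrite mulf_eq0 expf_eq0 (negPf a0) andbF.
  move=> /(nthP 0)[n lt e]; rewrite szr in lt; exists (Ordinal lt).
  apply/(eq_pointP Q0 (R0 _)); rewrite /R /= e eQ' crossZl crossvv scaler0 //.
have Q0 : Q != 0.
  apply: contraNneq (R0 i) => Q0; have /andP[_] := eQ.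
  by move=> /sub_rVP[a ->]; rewrite Q0 scaler0.
have [a e] : exists a, Q = a *: R i.
  apply: (cross_eq0P (R0 i)); rewrite crossC.
  by move: eQ => /(eq_pointP Q0 (R0 i)) ->; rewrite oppr0.
split; first by split=> //; rewrite e (meval_scale _ _ hf) fR mulr0.
by split=> //; apply/mulmx_tr_eq0; rewrite e dotZl RL mulr0.
Qed.

End Transversality.

(** * Second derivatives *)

Section Gradient.
Variable K : closedFieldType.
Implicit Types (u v w P Q L : 'rV[K]_3) (f g h p : {mpoly K[3]}).

Lemma gradientD p h P : gradient (p + h) P = gradient p P + gradient h P.
Proof. by apply/rowP => i; rewrite !mxE mderivD rmorphD. Qed.

Lemma gradientN p P : gradient (- p) P = - gradient p P.
Proof. by apply/rowP => i; rewrite !mxE mderivN rmorphN. Qed.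

Lemma gradientM p h P :
  gradient (p * h) P = p.@[P 0] *: gradient h P + h.@[P 0] *: gradient p P.
Proof.
apply/rowP => i; rewrite !mxE mderivM rmorphD !rmorphM /=; ring.
Qed.

Lemma gradient_sum (I : finType) (F : I -> {mpoly K[3]}) P :
  gradient (\sum_i F i) P = \sum_i gradient (F i) P.
Proof.
elim/big_rec2: _ => [|i y x _ <-]; last exact: gradientD.
by apply/rowP => j; rewrite !mxE mderiv0 rmorph0.
Qed.

Lemma dot_sumr u (I : finType) (F : I -> 'rV[K]_3) :
  dot u (\sum_i F i) = \sum_i dot u (F i).
Proof.
rewrite /dot exchange_big; apply: eq_bigr => j _ /=.
by rewrite summxE mulr_sumr.
Qed.

Lemma dot_gradientX v P i : dot v (gradient 'X_i P) = v 0 i.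
Proof.
rewrite /dot (bigD1 i) //= mxE mderiv_XU eqxx rmorph1 mulr1 big1 ?addr0 // => j /negPf nj.
by rewrite mxE mderiv_XU nj rmorph0 mulr0.
Qed.

Lemma tangent_divides f h v P : divides f h -> f.@[P 0] = 0 ->
  dot v (gradient f P) = 0 -> dot v (gradient h P) = 0.
Proof.
move=> [r ->] fP fv.
by rewrite gradientM fP scale0r addr0 dotZr fv mulr0.
Qed.

(** The Hessian matrix of f at P applied to v, or the differential of the Gauss
    map in the direction v. *)
Definition hessian_along f P v : 'rV[K]_3 := \row_i dot v (gradient f^`M(i) P).

Lemma dot_hessianC f P u v : dot u (hessian_along f P v) = dot v (hessian_along f P u).
Proof.
rewrite /dot.
under eq_bigr => i _ do rewrite mxE /dot mulr_sumr.
under [RHS]eq_bigr => i _ do rewrite mxE /dot mulr_sumr.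
rewrite exchange_big; apply: eq_bigr => i _; apply: eq_bigr => j _ /=.
by rewrite !mxE mderiv_comm mulrCA.
Qed.

(** This is the Euler relation for each partial derivative of f, a form of degree
    d - 1. *)
Lemma hessian_euler d f P : f \is d.-homog ->
  hessian_along f P P = gradient f P *+ d.-1.
Proof.
move=> hf; apply/rowP => i; rewrite mxE (euler_eval _ (dhomog_mderiv i hf)).
by rewrite mulmxnE mxE.
Qed.

Lemma gradient_comp p (t : 3.-tuple {mpoly K[3]}) P :
  gradient (p \mPo t) P =
    \sum_k p^`M(k).@[fun i => (tnth t i).@[P 0]] *: gradient (tnth t k) P.
Proof.
apply/rowP => j; rewrite mxE mderiv_comp rmorph_sum summxE; apply: eq_bigr => k _.
by rewrite rmorphM /= comp_mpoly_meval !mxE.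
Qed.

End Gradient.

(** * Reflexive curves are Frobenius classical *)

Section Frobenius.
Variables (K : closedFieldType) (p k : nat).
Hypotheses (pK : p \in [pchar K]) (k0 : (0 < k)%N).
Implicit Types (u v w P Q L : 'rV[K]_3) (f g h : {mpoly K[3]}).
Let q := (p ^ k)%N.

Definition frobenius P : 'rV[K]_3 := \row_i P 0 i ^+ q.

Lemma q_gt1 : (1 < q)%N.
Proof. by rewrite -(expn0 p) ltn_exp2l // prime_gt1 // (pcharf_prime pK). Qed.

Lemma natr_q : q%:R = 0 :> K.
Proof. by apply/eqP; rewrite -(dvdn_pcharf pK) dvdn_exp. Qed.

(** On the curve, it vanishes where the tangent line at P contains frobenius P. *)
Definition frobenius_form f : {mpoly K[3]} := \sum_i 'X_i ^+ q * f^`M(i).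

Lemma dhomog_frobenius_form d f : f \is d.-homog -> frobenius_form f \is (q + d.-1)%N.-homog.
Proof.
move=> hf; rewrite rpred_sum // => i _; apply: dhomogM; last exact: dhomog_mderiv.
have hX : ('X_i : {mpoly K[3]}) \is 1.-homog by rewrite dhomogX /= mdeg1.
by have := dhomogMn q hX; rewrite mul1n.
Qed.

Lemma meval_frobenius_form f P :
  (frobenius_form f).@[P 0] = dot (frobenius P) (gradient f P).
Proof.
rewrite rmorph_sum; apply: eq_bigr => i _.
by rewrite !mxE rmorphM rmorphXn /= mevalXU.
Qed.

Lemma gradient_Xq i P : gradient ('X_i ^+ q) P = 0.
Proof.
apply/rowP => j; rewrite !mxE mpolyXn mderivX mulmnE natrM natr_q mulr0 scale0r.
by rewrite rmorph0.
Qed.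

(** The q-th powers are constants for differentiation. *)
Lemma gradient_frobenius_form f P v :
  dot v (gradient (frobenius_form f) P) = dot (frobenius P) (hessian_along f P v).
Proof.
rewrite gradient_sum dot_sumr; apply: eq_bigr => i _.
rewrite gradientM gradient_Xq scaler0 addr0 dotZr !mxE.
by rewrite rmorphXn /= mevalXU.
Qed.

(** The points of the plane fixed by Frobenius have representatives with
    coordinates among the finitely many roots s of X^q - X.  A line avoiding all
    of them meets the curve in a point which is moved. *)
Lemma exists_moved_point f d : f != 0 -> f \is d.-homog -> (0 < d)%N ->
  exists2 P, zero_locus f P & cross P (frobenius P) != 0.
Proof.
move=> f0 hf d0.
have [s es] := closed_field_poly_normal ('X^q - 'X : {poly K}).
have XqX0 : 'X^q - 'X != 0 :> {poly K}.
  by rewrite -size_poly_eq0 size_polyDl ?size_polyXn // size_polyN size_polyX ltnS q_gt1.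
have memS x : x ^+ q = x -> x \in s.
  move=> e; rewrite -root_prod_XsubC -(@rootZ _ _ (lead_coef ('X^q - 'X))) ?lead_coef_eq0 //.
  by rewrite -es /root hornerD hornerN hornerXn hornerX e subrr.
pose ws := [seq w <- [seq row3 a.1 a.2 c | a <- [seq (x, y) | x <- s, y <- s], c <- s] | w != 0].
have ws0 w : w \in ws -> w != 0 by rewrite mem_filter => /andP[].
have ws0' w : w \in row3 1 0 0 :: ws -> w != 0.
  by rewrite inE => /orP[/eqP->|/ws0//]; exact: row3_100_neq0.
have [l [_ lP]] := generic_point (oner_neq0 _) ws0'.
have l0 : l != 0.
  by have := lP _ (mem_head _ _); apply: contraNneq => ->; rewrite dot0r.
have [P [P0 fP]] := plane_curves_meet f0 (linear_form_neq0 l0) hf (dhomog_linear_form l) d0 isT.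
rewrite meval_linear_form => lP0; exists P => //.
apply/eqP => /(cross_eq0P P0)[c ec].
have [i Pi] := exists_coord_neq0 P0.
have fixed j : P 0 j ^+ q = c * P 0 j by move/rowP: ec => /(_ j); rewrite !mxE.
have c0 : c != 0.
  by apply: contraNneq Pi => c0; have := fixed i; rewrite c0 mul0r => /eqP; rewrite expf_eq0 => /andP[_ /eqP->].
pose w := (P 0 i)^-1 *: P.
have wS j : w 0 j \in s.
  apply: memS; rewrite mxE exprMn exprVn !fixed invfM mulrACA mulVf // mul1r //.
have wws : w \in ws.
  rewrite mem_filter scaler_eq0 invr_eq0 negb_or Pi P0 /=.
  apply/allpairsP; exists ((w 0 o0, w 0 o1), w 0 o2); split=> //=; last first.
    by apply: row3P; rewrite row3E.
  by apply/allpairsP; exists (w 0 o0, w 0 o1); split=> /=.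
have := lP w; rewrite inE wws orbT dotC dotZr lP0 mulr0 eqxx.
by move=> /(_ isT).
Qed.

(** A nonzero derivative would have smaller degree than g. *)
Lemma mderiv_eq0_of_divides g e i : g \is e.-homog -> divides g g^`M(i) -> g^`M(i) = 0.
Proof.
move=> hg [r er]; apply/eqP/negPn/negP => gi0.
have [r0 g0] : r != 0 /\ g != 0.
  by apply/andP; rewrite -negb_or -mulf_eq0 -er.
have eg : e = (msize g).-1 := dhomog_uniq g0 hg (dhomog_msize hg).
have hgi := dhomog_mderiv i hg.
have egi : e.-1 = (msize g^`M(i)).-1 := dhomog_uniq gi0 hgi (dhomog_msize hgi).
have e0 : (0 < e)%N.
  rewrite lt0n; apply/eqP => e0; move: hg; rewrite e0 => /homog0_const c.
  by rewrite c mderivC eqxx in gi0.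
have := msizeM r0 g0; rewrite -er => szM.
have : (msize g <= msize g^`M(i))%N.
  rewrite szM; have : (0 < msize r)%N by rewrite lt0n msize_poly_eq0.
  by case: (msize r) => // n _; rewrite addSn leq_addl.
rewrite -(prednK (n := msize g)) ?lt0n ?msize_poly_eq0 // -eg.
rewrite -(prednK (n := msize g^`M(i))) ?lt0n ?msize_poly_eq0 // -egi prednK //.
by rewrite ltnn.
Qed.

(** Otherwise the derivatives of g vanish on the dual curve, so g divides them
    and they are all zero.  Then g = 0 has no smooth point, its dual curve is
    empty, and by biduality so is the curve f = 0. *)
Lemma dual_gradient_neq0 f g d : f \is d.-homog ->
  (exists P, zero_locus f P) -> smooth_curve f ->
  reduced_equation g (dual_curve f) -> (forall P, zero_locus f P <-> dual_curve g P) ->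
  exists2 P, zero_locus f P & gradient g (gradient f P) != 0.
Proof.
move=> hf [P1 P1f] sm_f [[e hg] hred] bidual; apply: NNPP => no.
have van P i : zero_locus f P -> (g^`M(i)).@[(gradient f P) 0] = 0.
  move=> fP; have : gradient g (gradient f P) = 0.
    by apply/eqP/negPn/negP => h; apply: no; exists P.
  by move=> /rowP/(_ i); rewrite !mxE.
have gi0 i : g^`M(i) = 0.
  apply: (mderiv_eq0_of_divides hg); have hgi := dhomog_mderiv i hg.
  apply/(hred _ _ hgi) => Q [Q0 Qcl]; apply: (Qcl _ _ hgi) => L [P [fP _]].
  move=> /andP[/sub_rVP[c ->] _].
  by rewrite (meval_scale _ _ hgi) van // mulr0.
have [_] := (bidual P1).1 P1f; move=> /(_ 0%N 1 (dhomog1 _ _)) h1.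
have: (1 : {mpoly K[3]}).@[P1 0] = 0.
  apply: h1 => L [P [_]] /negP[]; apply/eqP/rowP => i.
  by rewrite !mxE gi0 rmorph0.
by rewrite rmorph1; apply/eqP; rewrite oner_eq0.
Qed.

(** B i is the i-th coordinate of grad g (grad f), and m a b is a coordinate of
    its cross product with the point.  Biduality makes m a b vanish on the curve,
    so that it is a multiple of f and its derivative along a tangent vector v
    vanishes.  If f divides the Frobenius form, then the derivative H of grad f
    along v is proportional to grad f, the differential of B along v is
    proportional to B by the Euler relation, and what remains of the derivative
    of m a b is a coordinate of the cross product of v with B. *)
Theorem frobenius_classical f d : prime_elt f -> (0 < d)%N -> f \is d.-homog ->
  smooth_curve f -> reflexive f -> ~ divides f (frobenius_form f).
Proof.
move=> fP d0 hf sm_f [g [redg bidual biduality]] dvdF.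
have f0 : f != 0 by have [] := fP.
have [P1 fP1 mvP1] := exists_moved_point f0 hf d0.
have [P0 fP0 GP0] := dual_gradient_neq0 hf (ex_intro _ P1 fP1) sm_f redg bidual.
have [[e hg] hred] := redg.
have [j0 Gj0] : exists j, (g^`M(j)).@[(gradient f P0) 0] != 0.
  apply/existsP; apply: contraR GP0 => /existsPn h; apply/eqP/rowP => j.
  by rewrite !mxE; apply/eqP/negPn; exact: h.
pose df := [tuple f^`M(i) | i < 3].
pose B i := g^`M(i) \mPo df.
have evB i P : (B i).@[P 0] = (g^`M(i)).@[(gradient f P) 0].
  by rewrite comp_mpoly_meval; apply: meval_eq => l; rewrite tnth_mktuple mxE.
have hB i : B i \is (e.-1 * d.-1)%N.-homog.
  by apply: dhomog_comp (dhomog_mderiv i hg) _ => l; rewrite tnth_mktuple dhomog_mderiv.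
(* The W ab are the coordinates of the cross product of P and frobenius P. *)
pose W (ab : 'I_3 * 'I_3) : {mpoly K[3]} := 'X_ab.1 * 'X_ab.2 ^+ q - 'X_ab.2 * 'X_ab.1 ^+ q.
have evW ab P : (W ab).@[P 0] = P 0 ab.1 * frobenius P 0 ab.2 - P 0 ab.2 * frobenius P 0 ab.1.
  by rewrite rmorphB !rmorphM !rmorphXn /= !mevalXU !mxE.
have hX i : ('X_i : {mpoly K[3]}) \is 1.-homog by rewrite dhomogX /= mdeg1.
have hXq i : ('X_i ^+ q : {mpoly K[3]}) \is q.-homog.
  by have := dhomogMn q (hX i); rewrite mul1n.
have hW ab : W ab \is (1 + q)%N.-homog.
  by apply: rpredB; apply: dhomogM.
have [ab Wab] : exists ab, (W ab).@[P1 0] != 0.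
  apply/existsP; apply: contraR mvP1 => /existsPn h; apply/eqP.
  have h' a b : P1 0 a * frobenius P1 0 b - P1 0 b * frobenius P1 0 a = 0.
    by apply/eqP/negPn; rewrite -(evW (a, b)); exact: h.
  by apply: row3P; rewrite [RHS]mxE /cross row3E h'.
have ndvdB : ~ divides f (B j0).
  by move=> [r er]; move: Gj0; rewrite -evB er rmorphM /= fP0.2 mulr0 eqxx.
have ndvdW : ~ divides f (W ab).
  by move=> [r er]; move: Wab; rewrite er rmorphM /= fP1.2 mulr0 eqxx.
have ndvdBW : ~ divides f (B j0 * W ab) by have [_ _ fPP] := fP; case/fPP.
have [P fPz] := exists_not_zero fP d0 hf (dhomogM (hB j0) (hW ab)) ndvdBW.
rewrite rmorphM mulf_eq0 negb_or /= evB evW => /andP[BP WP].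
have [P_neq0 fPe] := fPz.
have [_ G0] := sm_f P fPz; set G := gradient f P in G0.
have PG : dot P G = 0 by rewrite (euler_eval _ hf) fPe mul0rn.
have FG : dot (frobenius P) G = 0.
  by case: dvdF => r er; rewrite -meval_frobenius_form er rmorphM /= fPe mulr0.
have N0 : cross P (frobenius P) != 0.
  apply: contraNneq WP => /(cross_eq0P P_neq0)[c ->].
  by apply/eqP; rewrite !mxE; ring.
(* v and P span the tangent line at P. *)
have [u Pu] := dot_neq0 P_neq0; pose v := cross G u.
have vG : dot v G = 0 by rewrite dotC dot_cross_l.
have Pv : cross P v != 0.
  by rewrite double_cross PG scale0r subr0 scaler_eq0 negb_or Pu.
pose H := hessian_along f P v.
have PH : dot P H = 0.
  by rewrite dot_hessianC (hessian_euler _ hf) -scaler_nat dotZr vG mulr0.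
have FH : dot (frobenius P) H = 0.
  by rewrite -gradient_frobenius_form; apply: (tangent_divides dvdF fPe vG).
(* The space of vectors orthogonal to P and to frobenius P is a line. *)
have [mu eH] : exists mu, H = mu *: G.
  have perp w : dot P w = 0 -> dot (frobenius P) w = 0 ->
      cross w (cross P (frobenius P)) = 0.
    by move=> Pw Fw; rewrite double_cross ![dot w _]dotC Pw Fw !scale0r subrr.
  have [c eN] := cross_eq0P G0 (perp G PG FG).
  have c0 : c != 0 by apply: contraNneq N0 => c0; rewrite eN c0 scale0r.
  apply: (cross_eq0P G0); have := perp H PH FH; rewrite eN crossZr => /eqP.
  by rewrite scaler_eq0 (negPf c0) /= cross_eq0C => /eqP.
pose Gam := gradient g G.
have Gam0 : Gam != 0.
  by apply: contraNneq BP => /rowP/(_ j0); rewrite !mxE => ->.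
have dualP Q : zero_locus f Q -> gradient g (gradient f Q) != 0 ->
    cross Q (gradient g (gradient f Q)) = 0.
  move=> fQ gam0; have [_ gQ0] := sm_f Q fQ.
  have gQ : zero_locus g (gradient f Q).
    split=> //; have := (hred _ _ hg).2; apply; first by exists 1; rewrite mul1r.
    split=> // e1 h1 _ van; apply: van; exists Q; first exact: sm_f.
    by apply/(eq_pointP gQ0 gQ0); rewrite crossvv.
  have := biduality Q (sm_f Q fQ) (conj gQ gam0).
  by move=> /(eq_pointP gam0 fQ.1); rewrite crossC => /eqP; rewrite oppr_eq0 => /eqP.
pose m a b : {mpoly K[3]} := 'X_a * B b - 'X_b * B a.
have hm a b : m a b \is (1 + e.-1 * d.-1)%N.-homog by apply: rpredB; apply: dhomogM.
have evm a b Q : (m a b).@[Q 0] =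
    Q 0 a * gradient g (gradient f Q) 0 b - Q 0 b * gradient g (gradient f Q) 0 a.
  by rewrite rmorphB !rmorphM /= !mevalXU !evB !mxE.
have prop0 Q L a b : Q != 0 -> cross Q L = 0 -> Q 0 a * L 0 b - Q 0 b * L 0 a = 0.
  by move=> Q0 /(cross_eq0P Q0)[c ->]; rewrite !mxE; ring.
have dvdm a b : divides f (m a b).
  apply: (nullstellensatz fP d0 hf (hm a b)) => Q fQ; rewrite evm.
  have [->|gam0] := eqVneq (gradient g (gradient f Q)) 0; first by rewrite !mxE !mulr0 subrr.
  exact: prop0 fQ.1 (dualP Q fQ gam0).
have dB b : dot v (gradient (B b) P) = mu * (e.-1%:R * Gam 0 b).
  transitivity (dot H (gradient g^`M(b) G)).
    rewrite gradient_comp dot_sumr; apply: eq_bigr => l _.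
    rewrite dotZr tnth_mktuple mulrC !mxE; congr (_ * _).
    by apply: meval_eq => i; rewrite tnth_mktuple mxE.
  by rewrite eH dotZl (euler_eval _ (dhomog_mderiv b hg)) mxE mulr_natl.
have PGam : cross P Gam = 0 := dualP P fPz Gam0.
have vGam a b : v 0 a * Gam 0 b - v 0 b * Gam 0 a = 0.
  have := tangent_divides (dvdm a b) fPe vG.
  rewrite gradientD gradientN !gradientM -scaleN1r !dotDr !dotZr !dotDr !dotZr.
  rewrite !dot_gradientX !mevalXU !dB !evB.
  have -> : (g^`M(a)).@[G 0] = Gam 0 a by rewrite mxE.
  have -> : (g^`M(b)).@[G 0] = Gam 0 b by rewrite mxE.
  have := prop0 P Gam a b P_neq0 PGam; move: (P 0 a) (P 0 b) (Gam 0 a) (Gam 0 b) => x y z t e1.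
  have combine (A A1 A2 c : K) : A1 = 0 -> A2 = 0 -> A = A1 - c * A2 -> A = 0.
    by move=> -> -> ->; rewrite mulr0 subr0.
  by move=> e2; apply: (combine _ _ _ (mu * e.-1%:R) e2 e1); ring.
have [c eGam] := cross_eq0P P_neq0 PGam.
have c0 : c != 0 by apply: contraNneq Gam0 => c0; rewrite eGam c0 scale0r.
have : cross v Gam = 0 by apply: row3P; rewrite [RHS]mxE /cross row3E vGam.
rewrite eGam crossZr => /eqP; rewrite scaler_eq0 (negPf c0) cross_eq0C.
by rewrite (negPf Pv).
Qed.

End Frobenius.

(** * Counting rational lines and their points of tangency *)

Section RationalLines.
Variables (F : finFieldType) (K : closedFieldType) (iota : {rmorphism F -> K}).

(** Each line over F has a unique triple of coordinates whose first nonzero entry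
    is 1, which makes the number of lines q^2 + q + 1 visible in the index type. *)
Definition line_row (x : F * F + F + unit) : 'rV[F]_3 :=
  match x with
  | inl (inl (a, b)) => row3 1 a b
  | inl (inr b) => row3 0 1 b
  | inr _ => row3 0 0 1
  end.

Lemma line_row_neq0 x : line_row x != 0.
Proof.
apply/eqP => /rowP e; case: x e => [[[a b]|b]|u] e.
- by have := e o0; rewrite row3E mxE => /eqP; rewrite oner_eq0.
- by have := e o1; rewrite row3E mxE => /eqP; rewrite oner_eq0.
- by have := e o2; rewrite row3E mxE => /eqP; rewrite oner_eq0.
Qed.

Lemma map_row3 a b c : map_mx iota (row3 a b c) = row3 (iota a) (iota b) (iota c).
Proof. by apply: row3P; rewrite mxE !row3E. Qed.

Lemma map_line_row_neq0 x : map_mx iota (line_row x) != 0.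
Proof. by rewrite map_mx_eq0 line_row_neq0. Qed.

Lemma line_row_inj x y :
  cross (map_mx iota (line_row x)) (map_mx iota (line_row y)) = 0 -> x = y.
Proof.
move=> /(cross_eq0P (map_line_row_neq0 x))[c /rowP e].
have e0 := e o0; have e1 := e o1; have e2 := e o2; move: e0 e1 e2 {e}.
case: x => [[[a b]|b]|[]]; case: y => [[[a' b']|b']|[]];
  rewrite /line_row !map_row3 !mxE /= ?rmorph0 ?rmorph1 ?mulr0 ?mulr1.
- by move=> <-; rewrite !mul1r => /fmorph_inj -> /fmorph_inj ->.
- by move=> <-; rewrite !mul0r => /eqP; rewrite oner_eq0.
- by move=> <-; rewrite !mul0r => _ /eqP; rewrite oner_eq0.
- by move=> /eqP; rewrite oner_eq0.
- by move=> _ <-; rewrite !mul1r => /fmorph_inj ->.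
- by move=> _ <-; rewrite !mul0r => /eqP; rewrite oner_eq0.
- by move=> /eqP; rewrite oner_eq0.
- by move=> _ /eqP; rewrite oner_eq0.
- by [].
Qed.

End RationalLines.

Section Descent.
Variables (F : finFieldType) (K : closedFieldType) (iota : {rmorphism F -> K}).
Variables (p k : nat).
Hypotheses (pK : p \in [pchar K]) (cardF : #|F| = (p ^ k)%N).
Implicit Types (g : {mpoly F[3]}) (P u v : 'rV[K]_3).
Let q := (p ^ k)%N.
Local Notation frob := (frobenius p k).

Lemma frobD (x y : K) : (x + y) ^+ q = x ^+ q + y ^+ q.
Proof. by apply: exprDn_pchar; rewrite pnatX (pnatE _ (pcharf_prime pK)) pK. Qed.

Lemma iota_q a : iota a ^+ q = iota a.
Proof. by rewrite -rmorphXn /= /q -cardF expf_card. Qed.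

Lemma frobenius_map (L : 'rV[F]_3) : frob (map_mx iota L) = map_mx iota L.
Proof. by apply/rowP => i; rewrite !mxE iota_q. Qed.

Lemma frobeniusZ c u : frob (c *: u) = c ^+ q *: frob u.
Proof. by apply/rowP => i; rewrite !mxE exprMn. Qed.

Lemma q_gt0 : (0 < q)%N.
Proof. by rewrite expn_gt0 prime_gt0 // (pcharf_prime pK). Qed.

Lemma frobenius_neq0 u : u != 0 -> frob u != 0.
Proof.
apply: contraNneq => /rowP e; apply/eqP/rowP => i.
have := e i; rewrite !mxE => /eqP; rewrite expf_eq0 => /andP[_ /eqP //].
Qed.

Lemma dot_frobenius u v : dot (frob u) (frob v) = dot u v ^+ q.
Proof. by rewrite !dotE !mxE -!exprMn -!frobD. Qed.

(** The coefficients of g are fixed by Frobenius. *)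
Lemma meval_frobenius g P :
  (map_mpoly iota g).@[frob P 0] = (map_mpoly iota g).@[P 0] ^+ q.
Proof.
move: g; apply: mpoly_ring_ind => [c|i|g h eg eh|g h eg eh].
- by rewrite map_mpolyC !mevalC iota_q.
- by rewrite map_mpolyX !mevalXU mxE.
- by rewrite !rmorphD /= frobD; congr (_ + _); [exact: eg|exact: eh].
- by rewrite !rmorphM /= exprMn; congr (_ * _); [exact: eg|exact: eh].
Qed.

Lemma mderiv_map g i : (map_mpoly iota g)^`M(i) = map_mpoly iota g^`M(i).
Proof.
by apply/mpolyP => m; rewrite mcoeff_map_mpoly !mcoeff_deriv mcoeff_map_mpoly raddfMn.
Qed.

Lemma gradient_frobenius g P :
  gradient (map_mpoly iota g) (frob P) = frob (gradient (map_mpoly iota g) P).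
Proof. by apply/rowP => i; rewrite !mxE mderiv_map meval_frobenius. Qed.

Lemma map_mpoly_neq0 g : g != 0 -> map_mpoly iota g != 0.
Proof.
apply: contraNneq => /mpolyP e; apply/eqP/mpolyP => m.
have := e m; rewrite mcoeff_map_mpoly !mcoeff0 => /eqP.
by rewrite fmorph_eq0 => /eqP.
Qed.

Lemma dhomog_map g d : g \is d.-homog -> map_mpoly iota g \is d.-homog.
Proof.
move=> /dhomogP hg; apply/dhomogP => m; rewrite mcoeff_msupp mcoeff_map_mpoly fmorph_eq0.
by move=> h; apply: hg; rewrite mcoeff_msupp.
Qed.

End Descent.

Theorem theorem1p2 (p k q : nat) (F : finFieldType)
  (K : closedFieldType) (iota : {rmorphism F -> K})
  (d : nat) (f : {mpoly F[3]}) :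
  prime p -> (2 < p)%N -> (0 < k)%N -> q = (p ^ k)%N -> #|F| = q ->
  integralRange iota ->
  (0 < d)%N -> f != 0 -> f \is d.-homog ->
  smooth_curve (map_mpoly iota f) ->
  reflexive (map_mpoly iota f) ->
  (d <= q + 1)%N ->
  exists L : 'rV[F]_3,
    L != 0 /\ transverse d (map_mpoly iota f) (map_mx iota L).
Proof.
move=> p_pr _ k0 -> {q} cardF _ d0 f_neq0 f_hom sm_f refl_f le_dq.
have pK : p \in [pchar K].
  by rewrite (fmorph_pchar iota); exact: card_finPcharP cardF p_pr.
have f0 := map_mpoly_neq0 iota f_neq0; have hf := dhomog_map iota f_hom.
have mfrob := meval_frobenius iota pK cardF f; have gfrob := gradient_frobenius iota pK cardF f.
move: (map_mpoly iota f) f0 hf sm_f refl_f mfrob gfrob => {f_neq0 f_hom}f f0 hf sm_f refl_f mfrob gfrob.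
have fP := smooth_curve_prime d0 f0 hf sm_f.
have ndvd := frobenius_classical pK k0 fP d0 hf sm_f refl_f.
set q := (p ^ k)%N in le_dq cardF; pose frob := @frobenius K p k.
apply: NNPP => no.
pose L x := map_mx iota (@line_row F x).
have L0 x : L x != 0 := map_line_row_neq0 iota x.
have tangent x : exists P, [/\ zero_locus f P, dot P (L x) = 0 & cross (gradient f P) (L x) = 0].
  apply: NNPP => no_tan; apply: no; exists (line_row x); split; first exact: line_row_neq0.
  apply: (transverse_of_not_tangent d0 hf (L0 x)) => P Pf PL; apply/eqP => tan.
  by apply: no_tan; exists P.
have /fin_all_exists[Pt tanPt] := tangent.
pose G x := gradient f (Pt x).
have Pt0 x : Pt x != 0 by have [[]] := tanPt x.
have fPt x : f.@[Pt x 0] = 0 by have [[]] := tanPt x.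
have PtL x : dot (Pt x) (L x) = 0 by have [] := tanPt x.
have G0 x : G x != 0 by have [/sm_f[]] := tanPt x.
have GL x : exists c, G x = c *: L x.
  apply: (cross_eq0P (L0 x)); have [_ _ e] := tanPt x.
  by rewrite crossC -/(G x) e oppr0.
have frobL x : frob (L x) = L x := frobenius_map iota cardF _.
have PtG x : dot (Pt x) (G x) = 0 by rewrite (euler_eval _ hf) fPt mul0rn.
have fPtG x : dot (frob (Pt x)) (G x) = 0.
  have [c ->] := GL x.
  rewrite dotZr -frobL (dot_frobenius k pK) PtL expr0n.
  by rewrite gtn_eqF ?(q_gt0 k pK) ?mulr0.
have /fin_all_exists[v vP] : forall x, exists v, cross (Pt x) v != 0 /\ dot v (G x) = 0.
  move=> x; have [u Pu] := dot_neq0 (Pt0 x); exists (cross (G x) u); split.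
    by rewrite double_cross PtG scale0r subr0 scaler_eq0 negb_or Pu G0.
  by rewrite dotC dot_cross_l.
(* The pair (x, true) stands for the point of tangency of the line x, with weight
   two if it is rational; (x, false) stands for its conjugate, counted only if it
   is a different point. *)
pose rational x := cross (Pt x) (frob (Pt x)) == 0.
pose I : finType := ((F * F + F + unit) * bool)%type.
pose A := [pred i : I | i.2 || ~~ rational i.1].
pose P (i : I) := if i.2 then Pt i.1 else frob (Pt i.1).
have P0 i : P i != 0 by rewrite /P; case: i.2; rewrite ?frobenius_neq0.
have gradP i : exists2 c, c != 0 & gradient f (P i) = c *: L i.1.
  have [c e] := GL i.1; have c0 : c != 0.
    by apply: contraNneq (G0 i.1) => c0; rewrite e c0 scale0r.
  rewrite /P; case: i.2; first by exists c.
  exists (c ^+ q); first by rewrite expf_neq0.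
  by rewrite gfrob -/(G _) e frobeniusZ -/frob frobL.
have := @weighted_bezout K f (frobenius_form p k f) d (q + d.-1) I A P
  (fun i => v i.1) (fun i => i.2 && rational i.1) fP d0 hf
  (dhomog_frobenius_form p k hf) ndvd.
have -> : (\sum_(i in A) (i.2 && rational i.1).+1)%N = (#|{: F * F + F + unit}| * 2)%N.
  rewrite -sum_nat_const big_mkcond -(pair_bigA _ (fun x s =>
    if (x, s) \in A then (s && rational x).+1 else 0%N)) /=.
  apply: eq_bigr => x _; rewrite big_bool /= !inE /=.
  by case: (rational x).
suff H : [/\ forall i, i \in A -> [/\ P i != 0, f.@[P i 0] = 0 & (frobenius_form p k f).@[P i 0] = 0],
   {in A &, forall i j, cross (P i) (P j) = 0 -> i = j}
   & forall i, i \in A -> i.2 && rational i.1 -> [/\ cross (P i) (v i.1) != 0,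
      dot (v i.1) (gradient f (P i)) = 0 & dot (v i.1) (gradient (frobenius_form p k f) (P i)) = 0]].
  case: H => H1 H2 H3 /(_ H1 H2 H3).
  rewrite !card_sum card_prod card_unit cardF leqNgt => /negP[].
  apply: leq_ltn_trans (_ : (q + 1) * (q + q) < _)%N.
    by apply: leq_mul => //; rewrite leq_add2l -ltnS prednK // -addn1.
  by rewrite addnn -muln2 mulnA ltn_pmul2r // mulnDl mul1n addn1.
split.
- move=> [x s] _; split; rewrite ?P0 //; rewrite /P; case: s => //=.
    by rewrite mfrob fPt expr0n gtn_eqF ?(q_gt0 k pK).
    by rewrite meval_frobenius_form fPtG.
  by rewrite meval_frobenius_form gfrob (dot_frobenius k pK) fPtG expr0n gtn_eqF ?(q_gt0 k pK).
- move=> i j iA jA e.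
  have eij : i.1 = j.1.
    have [a ea] := cross_eq0P (P0 i) e; have a0 : a != 0.
      by apply: contraNneq (P0 j) => a0; rewrite ea a0 scale0r.
    have [c c0 ec] := gradP i; have [c' c'0] := gradP j.
    rewrite ea (gradientZ _ _ hf) ec => /(congr1 (cross (L i.1))).
    rewrite !crossZr crossvv !scaler0 => /esym/eqP; rewrite scaler_eq0 (negPf c'0).
    by move=> /eqP/line_row_inj.
  case: i j iA jA e eij => [x s] [y t] /= iA jA e exy; rewrite -{y}exy in jA e *.
  congr (_, _); case: s t iA jA e => [] [] //=; rewrite !inE /= /rational /P /=.
    by move=> _ /eqP.
  by rewrite cross_eq0C => /eqP h _ /h.
move=> [x s] _ /andP[/= s1 rx]; rewrite /P s1 /=; have [v1 v2] := vP x; split=> //.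
have [c ec] := cross_eq0P (Pt0 x) (eqP rx).
rewrite (gradient_frobenius_form pK k0) -/frob ec dotZl dot_hessianC (hessian_euler _ hf).
by rewrite -scaler_nat dotZr v2 !mulr0.
Qed.
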